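(* Fix $0<\alpha<1$ and let $\{\mathcal{A}^{(n)}\}_{n\ge1}$ and $\{\mathcal{B}^{(n)}\}_{n\ge1}$ be two sequences of infinite matrices (bounded operators on $\ell^2(\mathbb{N})$), each satisfying Hypothesis H($\alpha$). Then for every $\beta>\alpha$ and every integer $m\ge2$ there is a constant $C(m,\beta)$, independent of $n$, such that as $n\to\infty$ $$\left|\mathcal{C}^{(n)}_m(\mathcal{B}^{(n)})-\mathcal{C}^{(n)}_m(\mathcal{A}^{(n)})\right|\le C(m,\beta)\left\|P_{\{n-2mn^\beta,\,n+2mn^\beta\}}\left(\mathcal{B}^{(n)}-\mathcal{A}^{(n)}\right)P_{\{n-2mn^\beta,\,n+2mn^\beta\}}\right\|_1+o(1).$$
   Context: Hypothesis H($\alpha$): a sequence $\{\mathcal{A}^{(n)}\}$ of infinite matrices satisfies H($\alpha$) if (1) $\sup_n\|\mathcal{A}^{(n)}\|_\infty<\infty$ (operator norm on $\ell^2(\mathbb{N})$) and (2) there are constants $C,C'>0$ independent of $n$ with $|\mathcal{A}^{(n)}_{r,s}|\le Ce^{-C'|r-s|/n^\alpha}$ for all $r,s$. $P_n$ denotes the orthogonal projection on $\ell^2(\mathbb{N})$ onto the first $n$ coordinates ($P_k=0$ for $k\le0$); for $0<\ell_1<\ell_2$, $P_{\{\ell_1,\ell_2\}}=P_{[\ell_2]+1}-P_{[\ell_1]-1}$ with $[x]$ the integer part. For a bounded matrix $\mathcal{A}$ and $m\ge2$, $$\mathcal{C}^{(n)}_m(\mathcal{A})=\sum_{j=1}^m\frac{(-1)^{j+1}}{j}\sum_{\substack{l_1+\cdots+l_j=m\\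 l_i\ge1}}\frac{\operatorname{Tr}\mathcal{A}^{l_1}P_n\cdots\mathcal{A}^{l_j}P_n-\operatorname{Tr}\mathcal{A}^mP_n}{l_1!\cdots l_j!}.$$ $\|\cdot\|_1$ is the trace norm. *)

(* Defs.v *)
From Stdlib Require Import Reals Lra Lia ZArith List ClassicalEpsilon.
Import ListNotations.
Open Scope R_scope.

Definition Cx := (R * R)%type.
Definition Cre (z : Cx) : R := fst z.
Definition Cim (z : Cx) : R := snd z.
Definition C0 : Cx := (0, 0).
Definition C1 : Cx := (1, 0).
Definition Cadd (z w : Cx) : Cx := (Cre z + Cre w, Cim z + Cim w).
Definition Copp (z : Cx) : Cx := (- Cre z, - Cim z).
Definition Csub (z w : Cx) : Cx := Cadd z (Copp w).
Definition Cmul (z w : Cx) : Cx :=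
  (Cre z * Cre w - Cim z * Cim w, Cre z * Cim w + Cim z * Cre w).
Definition Cconj (z : Cx) : Cx := (Cre z, - Cim z).
Definition Cscale (a : R) (z : Cx) : Cx := (a * Cre z, a * Cim z).
Definition Cabs (z : Cx) : R := sqrt (Cre z ^ 2 + Cim z ^ 2).

Definition Rpick (P : R -> Prop) : R :=
  match excluded_middle_informative (exists x, P x) with
  | left H => proj1_sig (constructive_indefinite_description P H)
  | right _ => 0
  end.

(* limit of a real sequence (limits are unique, so this is the limit when it exists) *)
Definition Rlim (u : nat -> R) : R := Rpick (fun l => Un_cv u l).

Fixpoint Rfsum (N : nat) (f : nat -> R) : R :=
  match N with O => 0 | S k => Rfsum k f + f k end.
Fixpoint Cfsum (N : nat) (f : nat -> Cx) : Cx :=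
  match N with O => C0 | S k => Cadd (Cfsum k f) (f k) end.

Definition Csum (f : nat -> Cx) : Cx :=
  (Rlim (fun N => Cre (Cfsum N f)), Rlim (fun N => Cim (Cfsum N f))).

(* ---------- infinite matrices (indices 0,1,2,... = coordinates 1,2,3,... of l^2(N)) ---------- *)
Definition imat := nat -> nat -> Cx.
Definition mmul (A B : imat) : imat :=
  fun r s => Csum (fun k => Cmul (A r k) (B k s)).
Definition msub (A B : imat) : imat := fun r s => Csub (A r s) (B r s).
Definition mid : imat := fun r s => if Nat.eqb r s then C1 else C0.
Fixpoint mpow (A : imat) (l : nat) : imat :=
  match l with O => mid | S k => mmul A (mpow A k) end.
Definition mtrace (A : imat) : Cx := Csum (fun r => A r r).

(* operator norm on l^2(N) bounded by M (tested on finitely supported vectors) *)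
Definition op_norm_le (A : imat) (M : R) : Prop :=
  forall (N K : nat) (x : nat -> Cx),
    Rfsum K (fun r => (Cabs (Cfsum N (fun k => Cmul (A r k) (x k)))) ^ 2)
    <= M ^ 2 * Rfsum N (fun k => (Cabs (x k)) ^ 2).

Definition hypH (alpha : R) (A : nat -> imat) : Prop :=
  (exists M : R, forall n : nat, (1 <= n)%nat -> op_norm_le (A n) M) /\
  (exists c c' : R, 0 < c /\ 0 < c' /\
     forall (n r s : nat), (1 <= n)%nat ->
       Cabs (A n r s) <= c * exp (- c' * Rabs (INR r - INR s) / Rpower (INR n) alpha)).

(* P_k : projection onto the first k coordinates (P_k = 0 for k <= 0) *)
Definition Pz (k : Z) : imat :=
  fun r s => if (Nat.eqb r s && Z.ltb (Z.of_nat r) k)%bool then C1 else C0.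
Definition Pn (n : nat) : imat := Pz (Z.of_nat n).
Definition Pint (l1 l2 : R) : imat :=
  msub (Pz (Int_part l2 + 1)%Z) (Pz (Int_part l1 - 1)%Z).

Fixpoint compositions (j m : nat) : list (list nat) :=
  match j with
  | O => if Nat.eqb m 0 then [nil] else nil
  | S j' => flat_map (fun l1 => map (cons l1) (compositions j' (m - l1))) (seq 1 m)
  end.

Fixpoint prodP (A P : imat) (ls : list nat) : imat :=
  match ls with
  | nil => mid
  | l :: nil => mmul (mpow A l) P
  | l :: rest => mmul (mmul (mpow A l) P) (prodP A P rest)
  end.

Definition factprod (ls : list nat) : nat := fold_right (fun l acc => (fact l * acc)%nat) 1%nat ls.

Definition Cbigsum {T : Type} (f : T -> Cx) (s : list T) : Cx :=
  fold_right Cadd C0 (map f s).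

Definition cumulant (m n : nat) (A : imat) : Cx :=
  Cbigsum (fun j =>
    Cscale ((-1) ^ (j + 1) / INR j)
      (Cbigsum (fun ls =>
         Cscale (/ INR (factprod ls))
           (Csub (mtrace (prodP A (Pn n) ls)) (mtrace (mmul (mpow A m) (Pn n)))))
        (compositions j m)))
    (seq 1 m).

Definition supported_in (N : nat) (X : imat) : Prop :=
  forall r s, (N <= r)%nat \/ (N <= s)%nat -> X r s = C0.
Definition psd (N : nat) (Y : imat) : Prop :=
  (forall r s, Y s r = Cconj (Y r s)) /\
  forall x : nat -> Cx,
    0 <= Cre (Cfsum N (fun r => Cfsum N (fun s => Cmul (Cconj (x r)) (Cmul (Y r s) (x s))))).
Definition is_absval (N : nat) (X Y : imat) : Prop :=
  supported_in N Y /\ psd N Y /\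
  forall r s, (r < N)%nat -> (s < N)%nat ->
    Cfsum N (fun k => Cmul (Y r k) (Y k s)) = Cfsum N (fun k => Cmul (Cconj (X k r)) (X k s)).
Definition trace_norm (X : imat) : R :=
  Rpick (fun t => exists (N : nat) (Y : imat),
           supported_in N X /\ is_absval N X Y /\ t = Cre (Cfsum N (fun r => Y r r))).

Definition Pwin (m : nat) (beta : R) (n : nat) : imat :=
  Pint (INR n - 2 * INR m * Rpower (INR n) beta) (INR n + 2 * INR m * Rpower (INR n) beta).

(* Main.v *)
(** Expand the trace defect [Tr A^l1 P ... A^lj P - Tr A^m P] over closed paths of [m] steps.
    A path contributes only if it visits both sides of [n], and it can leave the window of
    half-width [L = 2 m n^beta] around [n] only if its total length is at least [2 L], which the
    exponential decay makes superpolynomially small.  So, up to [o(1)], [A] may be replaced by its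
    compression [W A W] to the window; for the compressed matrices the difference of the defects
    telescopes into terms [Tr (Z W (B - A) W)] with [Z] bounded in operator norm, and trace
    duality bounds each of them by the trace norm.  The path sums are carried out on [N x N]
    truncations, and [N] tends to infinity by Tannery's theorem. *)

From Stdlib Require Import Reals Lra Lia List ZArith ClassicalEpsilon.
From Coquelicot Require Complex.
From mathcomp Require all_boot all_order all_algebra sesquilinear spectral complex Rstruct ring zify.
Require Import Defs.
Open Scope R_scope.

(** * Limits of truncations *)

(** Compression to the window does not make the change of either trace small: a closed path far
    below [n] leaves the window, and it contributes to both traces. Only the difference of the two
    changes is small, so the quantity to estimate is a second difference, projected word against
    plain power and matrix against compression. It is propagated one factor at a time along a fixed
    column [s < n], with weights that record how much length a path has used or still needs to close
    up at [s]. The decay rate [c' / n^alpha] is split into halves. One half makes the sums over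
    paths converge, at a cost of order [n^alpha] per step. The other half pays for the length [2 L]
    and yields [exp (- 2 m c' n^(beta - alpha))], which absorbs every power of [n]. Finite
    truncations give access to the spectral theorem, hence to trace duality. The bounds obtained
    there are free of [N], and the compressed difference has finite support, so that its trace norm
    is already visible at finite size. *)

Lemma Rlim_eq (u : nat -> R) l : Un_cv u l -> Rlim u = l.
Proof.
  intros H; unfold Rlim, Rpick.
  destruct (excluded_middle_informative _) as [e|n].
  - destruct (constructive_indefinite_description _ e) as [l' H']; simpl.
    exact (UL_sequence _ _ _ H' H).
  - destruct n; exists l; exact H.
Qed.

Lemma Un_cv_const (c : R) : Un_cv (fun _ => c) c.
Proof. intros e He; exists O; intros; unfold Rdist; rewrite Rminus_diag, Rabs_R0; lra. Qed.

Lemma Un_cv_eventually (u v : nat -> R) l N0 :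
  (forall N, (N0 <= N)%nat -> u N = v N) -> Un_cv v l -> Un_cv u l.
Proof.
  intros E H e He; destruct (H e He) as [N1 H1]; exists (max N0 N1); intros n Hn.
  rewrite E by lia; apply H1; lia.
Qed.

Lemma Un_cv_le_eventually (u : nat -> R) l b N0 :
  (forall N, (N0 <= N)%nat -> u N <= b) -> Un_cv u l -> l <= b.
Proof.
  intros E H; apply Rnot_lt_le; intros Hlt.
  destruct (H (l - b)) as [N1 H1]; [lra|].
  specialize (H1 (max N0 N1) ltac:(lia)); specialize (E (max N0 N1) ltac:(lia)).
  unfold Rdist in H1; apply Rabs_def2 in H1; lra.
Qed.

Lemma Rfsum_le N f g : (forall k, (k < N)%nat -> f k <= g k) -> Rfsum N f <= Rfsum N g.
Proof. intros H; induction N; simpl; [lra|]; apply Rplus_le_compat; auto. Qed.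

Lemma Rfsum_scal N c f : Rfsum N (fun k => c * f k) = c * Rfsum N f.
Proof. induction N; simpl; [|rewrite IHN]; ring. Qed.

Lemma Rfsum_abs N f : Rabs (Rfsum N f) <= Rfsum N (fun k => Rabs (f k)).
Proof.
  induction N; simpl; [rewrite Rabs_R0; lra|].
  eapply Rle_trans; [apply Rabs_triang|]; lra.
Qed.

Lemma Rfsum_split N M f : (N <= M)%nat ->
  Rfsum M f = Rfsum N f + Rfsum (M - N) (fun k => f (N + k)%nat).
Proof.
  intros H; replace M with (N + (M - N))%nat at 1 by lia.
  induction (M - N)%nat as [|j IH]; simpl; [rewrite Nat.add_0_r; ring|].
  rewrite Nat.add_succ_r; simpl; rewrite IH; ring.
Qed.

Lemma Un_cv_Rfsum K (f : nat -> nat -> R) f0 :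
  (forall k, Un_cv (fun N => f N k) (f0 k)) ->
  Un_cv (fun N => Rfsum K (f N)) (Rfsum K f0).
Proof.
  intros H; induction K; simpl; [apply Un_cv_const|].
  apply (CV_plus (fun N => Rfsum K (f N)) (fun N => f N K)); auto.
Qed.

Lemma Rfsum_bounded_cv g G :
  (forall k, 0 <= g k) -> (forall K, Rfsum K g <= G) -> exists l, Un_cv (fun K => Rfsum K g) l.
Proof.
  intros H0 HG.
  destruct (growing_cv (fun K => Rfsum K g)) as [l Hl].
  - intros n; simpl; specialize (H0 n); lra.
  - exists G; intros x [i ->]; apply HG.
  - exists l; exact Hl.
Qed.

(** Dominated convergence along the diagonal: truncation shortens the sum and changes its terms at
    the same time. The summable [g] makes all tails uniformly small, and a fixed finite part
    converges termwise. Summability of [f0] is part of the conclusion, hence the existential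
    limit. *)
Lemma tannery (f : nat -> nat -> R) (f0 g : nat -> R) G :
  (forall N k, Rabs (f N k) <= g k) ->
  (forall k, Un_cv (fun N => f N k) (f0 k)) ->
  (forall K, Rfsum K g <= G) ->
  exists l, Un_cv (fun K => Rfsum K f0) l /\ Un_cv (fun N => Rfsum N (f N)) l.
Proof.
  intros Hf Hcv HG.
  assert (Hf0 : forall k, Rabs (f0 k) <= g k).
  { intros k; apply (Un_cv_le_eventually (fun N => Rabs (f N k)) _ _ 0); [intros; apply Hf|].
    apply cv_cvabs, Hcv. }
  assert (Hg : forall k, 0 <= g k) by (intros k; eapply Rle_trans; [apply Rabs_pos|apply Hf0]).
  destruct (Rfsum_bounded_cv g G Hg HG) as [lg Hlg].
  assert (Htail : forall h, (forall k, Rabs (h k) <= g k) -> forall N M, (N <= M)%nat ->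
     Rabs (Rfsum M h - Rfsum N h) <= Rfsum M g - Rfsum N g).
  { intros h Hh N M HNM; rewrite (Rfsum_split N M h), (Rfsum_split N M g) by assumption.
    replace (_ + _ - _) with (Rfsum (M - N) (fun k => h (N + k)%nat)) by ring.
    replace (_ + _ - _) with (Rfsum (M - N) (fun k => g (N + k)%nat)) by ring.
    eapply Rle_trans; [apply Rfsum_abs|]; apply Rfsum_le; intros; apply Hh. }
  assert (Hc : Cauchy_crit (fun K => Rfsum K f0)).
  { intros e He; destruct (CV_Cauchy _ (exist _ lg Hlg) e He) as [N HN].
    exists N; intros n p Hn Hp.
    destruct (Nat.le_ge_cases p n) as [Hpn|Hpn]; unfold Rdist.
    - eapply Rle_lt_trans; [apply (Htail f0 Hf0 p n Hpn)|].
      eapply Rle_lt_trans; [apply Rle_abs|]; apply HN; assumption.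
    - rewrite Rabs_minus_sym; eapply Rle_lt_trans; [apply (Htail f0 Hf0 n p Hpn)|].
      eapply Rle_lt_trans; [apply Rle_abs|]; apply HN; assumption. }
  destruct (R_complete _ Hc) as [l Hl]; exists l; split; [exact Hl|].
  intros e He.
  destruct (Hl (e / 4) ltac:(lra)) as [N1 H1].
  destruct (CV_Cauchy _ (exist _ lg Hlg) (e / 4) ltac:(lra)) as [N2 H2].
  set (K := max N1 N2).
  destruct (Un_cv_Rfsum K f f0 Hcv (e / 4) ltac:(lra)) as [N3 H3].
  exists (max K N3); intros n Hn.
  specialize (H1 K ltac:(lia)); specialize (H3 n ltac:(lia)).
  specialize (H2 n K ltac:(lia) ltac:(lia)).
  pose proof (Htail (f n) (Hf n) K n ltac:(lia)) as H4.
  unfold Rdist in *.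
  replace (Rfsum n (f n) - l) with
    ((Rfsum n (f n) - Rfsum K (f n)) + ((Rfsum K (f n) - Rfsum K f0) + (Rfsum K f0 - l))) by ring.
  pose proof (Rabs_triang (Rfsum n (f n) - Rfsum K (f n))
    ((Rfsum K (f n) - Rfsum K f0) + (Rfsum K f0 - l))).
  pose proof (Rabs_triang (Rfsum K (f n) - Rfsum K f0) (Rfsum K f0 - l)).
  pose proof (Rle_abs (Rfsum n g - Rfsum K g)); lra.
Qed.

Lemma Cx_eq (z w : Cx) : Cre z = Cre w -> Cim z = Cim w -> z = w.
Proof. destruct z, w; unfold Cre, Cim; simpl; congruence. Qed.

Lemma Cadd_0_r z : Cadd z C0 = z.
Proof. apply Cx_eq; unfold Cadd, C0, Cre, Cim; simpl; ring. Qed.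
Lemma Cmul_0_l z : Cmul C0 z = C0.
Proof. apply Cx_eq; unfold Cmul, C0, Cre, Cim; simpl; ring. Qed.
Lemma Cmul_0_r z : Cmul z C0 = C0.
Proof. apply Cx_eq; unfold Cmul, C0, Cre, Cim; simpl; ring. Qed.
Lemma Cmul_1_r z : Cmul z C1 = z.
Proof. apply Cx_eq; unfold Cmul, C1, Cre, Cim; simpl; ring. Qed.

Lemma Cabs_triang z w : Cabs (Cadd z w) <= Cabs z + Cabs w.
Proof. exact (Complex.Cmod_triangle z w). Qed.
Lemma Cabs_mul z w : Cabs (Cmul z w) = Cabs z * Cabs w.
Proof. exact (Complex.Cmod_mult z w). Qed.
Lemma Cabs_ge0 z : 0 <= Cabs z.
Proof. apply sqrt_pos. Qed.
Lemma Cabs_C0 : Cabs C0 = 0.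
Proof. exact Complex.Cmod_0. Qed.
Lemma Cabs_C1 : Cabs C1 = 1.
Proof. exact Complex.Cmod_1. Qed.
Lemma Cabs_scale a z : Cabs (Cscale a z) = Rabs a * Cabs z.
Proof.
  replace (Rabs a) with (Cabs (a, 0)) by exact (Complex.Cmod_R a).
  rewrite <- Cabs_mul; f_equal.
  apply Cx_eq; unfold Cscale, Cmul, Cre, Cim; simpl; ring.
Qed.
Lemma Cre_le_Cabs z : Rabs (Cre z) <= Cabs z.
Proof. eapply Rle_trans; [apply Rmax_l|exact (Complex.Rmax_Cmod z)]. Qed.
Lemma Cim_le_Cabs z : Rabs (Cim z) <= Cabs z.
Proof. eapply Rle_trans; [apply Rmax_r|exact (Complex.Rmax_Cmod z)]. Qed.

Lemma Cre_Cfsum N f : Cre (Cfsum N f) = Rfsum N (fun k => Cre (f k)).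
Proof. induction N; simpl; [reflexivity|]; rewrite <- IHN; reflexivity. Qed.
Lemma Cim_Cfsum N f : Cim (Cfsum N f) = Rfsum N (fun k => Cim (f k)).
Proof. induction N; simpl; [reflexivity|]; rewrite <- IHN; reflexivity. Qed.

Lemma Cfsum_ext N f g : (forall k, (k < N)%nat -> f k = g k) -> Cfsum N f = Cfsum N g.
Proof. intros H; induction N; simpl; [reflexivity|]; rewrite IHN, H; auto. Qed.

Lemma Cfsum_0 N f : (forall k, (k < N)%nat -> f k = C0) -> Cfsum N f = C0.
Proof.
  intros H; induction N; simpl; [reflexivity|]; rewrite IHN, H, Cadd_0_r; auto.
Qed.

Lemma Cfsum_widen N M f : (N <= M)%nat -> (forall k, (N <= k)%nat -> f k = C0) ->
  Cfsum M f = Cfsum N f.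
Proof.
  intros HM H; induction HM as [|M HM IH]; simpl; [reflexivity|].
  rewrite IH, H, Cadd_0_r; auto.
Qed.

Lemma Cabs_Cfsum N f : Cabs (Cfsum N f) <= Rfsum N (fun k => Cabs (f k)).
Proof.
  induction N; simpl; [rewrite Cabs_C0; lra|].
  eapply Rle_trans; [apply Cabs_triang|]; lra.
Qed.

Lemma Csum_finite N f : (forall k, (N <= k)%nat -> f k = C0) -> Csum f = Cfsum N f.
Proof.
  intros H; apply Cx_eq; unfold Csum; simpl; apply Rlim_eq;
  (eapply Un_cv_eventually; [|apply Un_cv_const]);
  intros M HM; simpl; rewrite (Cfsum_widen N M f HM H); reflexivity.
Qed.

Definition Ccv (u : nat -> Cx) (l : Cx) :=
  Un_cv (fun N => Cre (u N)) (Cre l) /\ Un_cv (fun N => Cim (u N)) (Cim l).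

Lemma Ccv_const z : Ccv (fun _ => z) z.
Proof. split; apply Un_cv_const. Qed.

Lemma Ccv_add u v a b : Ccv u a -> Ccv v b -> Ccv (fun N => Cadd (u N) (v N)) (Cadd a b).
Proof.
  intros [H1 H2] [H3 H4]; split; simpl;
  [exact (CV_plus _ _ _ _ H1 H3) | exact (CV_plus _ _ _ _ H2 H4)].
Qed.

Lemma Ccv_opp u a : Ccv u a -> Ccv (fun N => Copp (u N)) (Copp a).
Proof. intros [H1 H2]; split; simpl; [exact (CV_opp _ _ H1)|exact (CV_opp _ _ H2)]. Qed.

Lemma Ccv_sub u v a b : Ccv u a -> Ccv v b -> Ccv (fun N => Csub (u N) (v N)) (Csub a b).
Proof. intros H1 H2; apply Ccv_add; [|apply Ccv_opp]; assumption. Qed.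

Lemma Ccv_mul u v a b : Ccv u a -> Ccv v b -> Ccv (fun N => Cmul (u N) (v N)) (Cmul a b).
Proof.
  intros [H1 H2] [H3 H4]; split; simpl.
  - exact (CV_minus _ _ _ _ (CV_mult _ _ _ _ H1 H3) (CV_mult _ _ _ _ H2 H4)).
  - exact (CV_plus _ _ _ _ (CV_mult _ _ _ _ H1 H4) (CV_mult _ _ _ _ H2 H3)).
Qed.

Lemma Ccv_Cfsum K f f0 : (forall k, Ccv (fun N => f N k) (f0 k)) ->
  Ccv (fun N => Cfsum K (f N)) (Cfsum K f0).
Proof.
  intros H; induction K; simpl; [apply Ccv_const|].
  apply (Ccv_add (fun N => Cfsum K (f N)) (fun N => f N K)); auto.
Qed.

Lemma Ccv_eventually u v l N0 :
  (forall N, (N0 <= N)%nat -> u N = v N) -> Ccv v l -> Ccv u l.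
Proof.
  intros E [H1 H2]; split; (eapply Un_cv_eventually; [|eassumption]);
  intros N HN; simpl; rewrite (E N HN); reflexivity.
Qed.

(** The bound is squared before passing to the limit, so only sums and products of real limits
    occur. *)
Lemma Cabs_le_limit u l b N0 :
  (forall N, (N0 <= N)%nat -> Cabs (u N) <= b) -> Ccv u l -> Cabs l <= b.
Proof.
  intros E [H1 H2].
  assert (b0 : 0 <= b) by (eapply Rle_trans; [apply Cabs_ge0|apply (E N0); lia]).
  rewrite <- (sqrt_Rsqr b b0); unfold Cabs; apply sqrt_le_1_alt.
  pose proof (CV_plus _ _ _ _ (CV_mult _ _ _ _ H1 H1) (CV_mult _ _ _ _ H2 H2)) as H.
  apply (Un_cv_le_eventually _ _ (b * b) N0) in H; [unfold Rsqr; simpl; lra|].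
  intros N HN; specialize (E N HN).
  apply (Rmult_le_compat _ _ _ _ (Cabs_ge0 _) (Cabs_ge0 _) E) in E.
  unfold Cabs in E; rewrite sqrt_sqrt in E; [lra|].
  simpl; nra.
Qed.

Definition trunc (N : nat) (A : imat) : imat :=
  fun r s => if (Nat.ltb r N && Nat.ltb s N)%bool then A r s else C0.

Lemma trunc_in N A r s : (r < N)%nat -> (s < N)%nat -> trunc N A r s = A r s.
Proof.
  intros Hr Hs; unfold trunc.
  apply Nat.ltb_lt in Hr, Hs; rewrite Hr, Hs; reflexivity.
Qed.

Lemma trunc_out_r N A r s : (N <= s)%nat -> trunc N A r s = C0.
Proof.
  intros Hs; unfold trunc; apply Nat.ltb_ge in Hs; rewrite Hs, Bool.andb_false_r; reflexivity.
Qed.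

Lemma Cabs_trunc N A r s : Cabs (trunc N A r s) <= Cabs (A r s).
Proof.
  unfold trunc; destruct (_ && _)%bool; [lra|]; rewrite Cabs_C0; apply Cabs_ge0.
Qed.

Definition row_summable (S : R) (A : imat) :=
  forall r K, Rfsum K (fun k => Cabs (A r k)) <= S.

(** Row [r] of [A] times [K] is the dominating sequence for Tannery. The bound [S * K] is proved
    alongside because it is the domination for the next factor in the induction on powers. *)
Lemma mmul_trunc_cv S A (Y : nat -> imat) Y0 K s :
  row_summable S A -> (forall N k, Cabs (Y N k s) <= K) ->
  (forall k, Ccv (fun N => Y N k s) (Y0 k s)) -> forall r,
  Ccv (fun N => mmul (trunc N A) (Y N) r s) (mmul A Y0 r s) /\
  (forall N, Cabs (mmul (trunc N A) (Y N) r s) <= S * K).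
Proof.
  intros HS HK Hcv r.
  assert (Hfin : forall N, mmul (trunc N A) (Y N) r s =
    Cfsum N (fun k => Cmul (trunc N A r k) (Y N k s))).
  { intros N; apply Csum_finite; intros k Hk; rewrite trunc_out_r, Cmul_0_l; auto. }
  assert (K0 : 0 <= K) by (eapply Rle_trans; [apply Cabs_ge0|apply (HK O O)]).
  assert (Hb : forall N k, Cabs (Cmul (trunc N A r k) (Y N k s)) <= K * Cabs (A r k)).
  { intros N k; rewrite Cabs_mul, Rmult_comm.
    apply Rmult_le_compat; auto using Cabs_ge0, Cabs_trunc. }
  assert (HG : forall M, Rfsum M (fun k => K * Cabs (A r k)) <= S * K).
  { intros M; rewrite Rfsum_scal, Rmult_comm; apply Rmult_le_compat_r; auto. }
  split.
  - assert (Hk : forall k, Ccv (fun N => Cmul (trunc N A r k) (Y N k s))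
                              (Cmul (A r k) (Y0 k s))).
    { intros k; apply Ccv_mul; [|apply Hcv].
      apply (Ccv_eventually _ (fun _ => A r k) _ (Datatypes.S (max r k))); [|apply Ccv_const].
      intros N HN; apply trunc_in; lia. }
    destruct (tannery (fun N k => Cre (Cmul (trunc N A r k) (Y N k s)))
      (fun k => Cre (Cmul (A r k) (Y0 k s))) _ _
      (fun N k => Rle_trans _ _ _ (Cre_le_Cabs _) (Hb N k)) (fun k => proj1 (Hk k)) HG)
      as [l1 [Ha1 Hb1]].
    destruct (tannery (fun N k => Cim (Cmul (trunc N A r k) (Y N k s)))
      (fun k => Cim (Cmul (A r k) (Y0 k s))) _ _
      (fun N k => Rle_trans _ _ _ (Cim_le_Cabs _) (Hb N k)) (fun k => proj2 (Hk k)) HG)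
      as [l2 [Ha2 Hb2]].
    replace (mmul A Y0 r s) with (l1, l2).
    + split.
      * apply (Un_cv_eventually _ _ _ O) with (2 := Hb1).
        intros N _; cbv beta; rewrite Hfin; apply Cre_Cfsum.
      * apply (Un_cv_eventually _ _ _ O) with (2 := Hb2).
        intros N _; cbv beta; rewrite Hfin; apply Cim_Cfsum.
    + symmetry; apply Cx_eq; unfold mmul, Csum; simpl; apply Rlim_eq.
      * apply (Un_cv_eventually _ _ _ O) with (2 := Ha1); intros; apply Cre_Cfsum.
      * apply (Un_cv_eventually _ _ _ O) with (2 := Ha2); intros; apply Cim_Cfsum.
  - intros N; rewrite Hfin; eapply Rle_trans; [apply Cabs_Cfsum|].
    eapply Rle_trans; [apply Rfsum_le; intros; apply Hb|apply HG].
Qed.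

Lemma mpow_trunc_cv S A : row_summable S A -> forall l r s,
  Ccv (fun N => mpow (trunc N A) l r s) (mpow A l r s) /\
  (forall N, Cabs (mpow (trunc N A) l r s) <= S ^ l).
Proof.
  intros HS l; induction l as [|l IH]; intros r s.
  - split; [exact (Ccv_const (mid r s))|]; intros N; simpl; unfold mid.
    destruct (Nat.eqb r s); [rewrite Cabs_C1|rewrite Cabs_C0]; lra.
  - apply (mmul_trunc_cv S A (fun N => mpow (trunc N A) l) (mpow A l) (S ^ l) s); auto.
    + intros; apply IH.
    + intros; apply IH.
Qed.

Lemma mmul_diag_r (W : imat) w X r s :
  (forall r s, W r s = if (Nat.eqb r s && w r)%bool then C1 else C0) ->
  mmul X W r s = if w s then X r s else C0.
Proof.
  intros HW; unfold mmul; rewrite (Csum_finite (S s)).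
  - simpl; rewrite Cfsum_0.
    + rewrite HW, Nat.eqb_refl; simpl; destruct (w s); rewrite ?Cmul_1_r, ?Cmul_0_r;
      apply Cx_eq; unfold Cadd, C0, Cre, Cim; simpl; ring.
    + intros k Hk; rewrite HW; replace (Nat.eqb k s) with false; [apply Cmul_0_r|].
      symmetry; apply Nat.eqb_neq; lia.
  - intros k Hk; rewrite HW; replace (Nat.eqb k s) with false; [apply Cmul_0_r|].
    symmetry; apply Nat.eqb_neq; lia.
Qed.

Lemma mmul_diag_l (W : imat) w X r s :
  (forall r s, W r s = if (Nat.eqb r s && w r)%bool then C1 else C0) ->
  mmul W X r s = if w r then X r s else C0.
Proof.
  intros HW; unfold mmul; rewrite (Csum_finite (S r)).
  - simpl; rewrite Cfsum_0.
    + rewrite HW, Nat.eqb_refl; simpl; destruct (w r); rewrite ?Cmul_0_l;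
      apply Cx_eq; unfold Cadd, Cmul, C0, C1, Cre, Cim; simpl; ring.
    + intros k Hk; rewrite HW; replace (Nat.eqb r k) with false; [apply Cmul_0_l|].
      symmetry; apply Nat.eqb_neq; lia.
  - intros k Hk; rewrite HW; replace (Nat.eqb r k) with false; [apply Cmul_0_l|].
    symmetry; apply Nat.eqb_neq; lia.
Qed.

Lemma mmul_Pn X n r s : mmul X (Pn n) r s = if Nat.ltb s n then X r s else C0.
Proof.
  rewrite (mmul_diag_r _ (fun r => Z.ltb (Z.of_nat r) (Z.of_nat n))) by reflexivity.
  destruct (Nat.ltb_spec s n), (Z.ltb_spec (Z.of_nat s) (Z.of_nat n)); reflexivity || lia.
Qed.

Lemma mmul_Pn_mmul X Y n r s :
  mmul (mmul X (Pn n)) Y r s = Cfsum n (fun k => Cmul (X r k) (Y k s)).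
Proof.
  unfold mmul at 1; rewrite (Csum_finite n).
  - apply Cfsum_ext; intros k Hk; rewrite mmul_Pn; apply Nat.ltb_lt in Hk; rewrite Hk; reflexivity.
  - intros k Hk; rewrite mmul_Pn; apply Nat.ltb_ge in Hk; rewrite Hk; apply Cmul_0_l.
Qed.

Lemma prodP_out n A ls r s : ls <> nil -> (n <= s)%nat -> prodP A (Pn n) ls r s = C0.
Proof.
  revert r; induction ls as [|l [|l' ls] IH]; intros r Hl Hs; [congruence| |].
  - simpl; rewrite mmul_Pn; apply Nat.ltb_ge in Hs; rewrite Hs; reflexivity.
  - change (mmul (mmul (mpow A l) (Pn n)) (prodP A (Pn n) (l' :: ls)) r s = C0).
    rewrite mmul_Pn_mmul; apply Cfsum_0; intros k _.
    rewrite IH, Cmul_0_r; congruence.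
Qed.

Lemma prodP_trunc_cv S A n ls : row_summable S A -> forall r s,
  Ccv (fun N => prodP (trunc N A) (Pn n) ls r s) (prodP A (Pn n) ls r s).
Proof.
  intros HS; induction ls as [|l [|l' ls] IH]; intros r s.
  - exact (Ccv_const (mid r s)).
  - simpl; apply (Ccv_eventually _ (fun N => if Nat.ltb s n then mpow (trunc N A) l r s else C0) _ O).
    + intros; apply mmul_Pn.
    + rewrite mmul_Pn; destruct (Nat.ltb s n); [apply (mpow_trunc_cv S A HS)|apply Ccv_const].
  - apply (Ccv_eventually _ (fun N => Cfsum n (fun k =>
       Cmul (mpow (trunc N A) l r k) (prodP (trunc N A) (Pn n) (l' :: ls) k s))) _ O).
    + intros N _; apply mmul_Pn_mmul.
    + change (prodP A (Pn n) (l :: l' :: ls)) with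
        (mmul (mmul (mpow A l) (Pn n)) (prodP A (Pn n) (l' :: ls))).
      rewrite mmul_Pn_mmul; apply Ccv_Cfsum; intros k; apply Ccv_mul; [|apply IH].
      apply (mpow_trunc_cv S A HS).
Qed.

(** The trailing projection kills all columns from [n] on. The empty list must be excluded: its
    product is the identity, which has no finite trace. *)
Lemma mtrace_prodP A n ls N : ls <> nil -> (n <= N)%nat ->
  mtrace (prodP A (Pn n) ls) = Cfsum N (fun r => prodP A (Pn n) ls r r).
Proof.
  intros Hl HN; apply Csum_finite; intros k Hk; apply prodP_out; [assumption|lia].
Qed.

Lemma mtrace_prodP_cv S A n ls : row_summable S A -> ls <> nil ->
  Ccv (fun N => mtrace (prodP (trunc N A) (Pn n) ls)) (mtrace (prodP A (Pn n) ls)).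
Proof.
  intros HS Hl; rewrite (mtrace_prodP A n ls n) by (auto; lia).
  apply (Ccv_eventually _ (fun N => Cfsum n (fun r => prodP (trunc N A) (Pn n) ls r r)) _ O).
  - intros; apply mtrace_prodP; auto.
  - apply Ccv_Cfsum; intros k; apply (prodP_trunc_cv S A n ls HS).
Qed.

(** * Exponential decay *)

Definition idist (r k : nat) : R := Rabs (INR r - INR k).

Definition ekern (theta : R) (r k : nat) : R := exp (- theta * idist r k).

(** With [q = exp (- theta)], the two-sided geometric series sums to [(1 + q) / (1 - q)]. The bounds
    [1 + q <= 2] and [1 - q >= theta / (1 + theta)] give this value, of order [1 / theta]. *)
Definition ekern_mass (theta : R) : R := 2 + 2 / theta.

Lemma exp_neg_le theta : 0 < theta -> theta / (1 + theta) <= 1 - exp (- theta).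
Proof.
  intros H; rewrite exp_Ropp.
  assert (/ exp theta <= / (1 + theta)).
  { apply Rinv_le_contravar; [lra|]; apply exp_ineq1_le. }
  replace (theta / (1 + theta)) with (1 - / (1 + theta)) by (field; lra); lra.
Qed.

Lemma ekern_row_sum theta r K : 0 < theta ->
  Rfsum K (ekern theta r) <= ekern_mass theta.
Proof.
  unfold ekern_mass; intros Ht; set (q := exp (- theta)).
  assert (q0 : 0 < q) by apply exp_pos.
  (* Geometric sums in closed form, first while the index is left of [r], then past it; the term
     [- q^(r + 1)] is dropped in both cases. *)
  assert (H : ((K <= r)%nat -> (1 - q) * Rfsum K (ekern theta r)
                 <= exp (- theta * (INR r + 1 - INR K))) /\
              ((r < K)%nat -> (1 - q) * Rfsum K (ekern theta r)
                 <= 1 + q - exp (- theta * (INR K - INR r)))).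
  { induction K as [|K [IH1 IH2]].
    - split; [|lia]; intros _; simpl; rewrite Rmult_0_r; apply Rlt_le, exp_pos.
    - assert (Hq : forall x, exp (- theta * (x + 1)) = q * exp (- theta * x)).
      { intros x; unfold q; rewrite <- exp_plus; f_equal; ring. }
      simpl Rfsum; rewrite Rmult_plus_distr_l; split; intros HK.
      + apply le_INR in HK as HK'; rewrite S_INR in *.
        specialize (IH1 ltac:(lia)); unfold ekern at 2, idist; rewrite Rabs_right by lra.
        replace (INR r + 1 - INR K) with (INR r - INR K + 1) in IH1 by ring.
        rewrite Hq in IH1.
        replace (INR r + 1 - (INR K + 1)) with (INR r - INR K) by ring; lra.
      + destruct (Nat.eq_dec r K) as [->|Hne].
        * specialize (IH1 (le_n K)); replace (INR K + 1 - INR K) with 1 in IH1 by ring.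
          rewrite S_INR; unfold ekern at 2, idist; replace (INR K + 1 - INR K) with 1 by ring.
          rewrite Rminus_diag, Rabs_R0, Rmult_0_r, exp_0.
          rewrite !Rmult_1_r in *; fold q in IH1 |- *; lra.
        * specialize (IH2 ltac:(lia)).
          assert (Hr : INR r <= INR K) by (apply le_INR; lia).
          rewrite S_INR; unfold ekern at 2, idist; rewrite Rabs_minus_sym, Rabs_right by lra.
          replace (INR K + 1 - INR r) with (INR K - INR r + 1) by ring; rewrite Hq; lra. }
  assert (H2 : (1 - q) * Rfsum K (ekern theta r) <= 2).
  { pose proof (exp_neg_le theta Ht) as Hq; fold q in Hq.
    assert (0 < theta / (1 + theta)) by (apply Rdiv_lt_0_compat; lra).
    destruct (Nat.le_gt_cases K r) as [HK|HK].
    - apply le_INR in HK as HK'; specialize (proj1 H HK) as H1.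
      assert (exp (- theta * (INR r + 1 - INR K)) <= exp 0).
      { apply Rlt_le, exp_increasing; nra. }
      rewrite exp_0 in *; lra.
    - specialize (proj2 H HK) as H1; pose proof (exp_pos (- theta * (INR K - INR r))); lra. }
  pose proof (exp_neg_le theta Ht) as Hq; fold q in Hq.
  assert (Hs0 : 0 <= Rfsum K (ekern theta r)).
  { clear; induction K; simpl; [lra|]; pose proof (exp_pos (- theta * idist r K)); unfold ekern at 2; lra. }
  assert (H3 : theta / (1 + theta) * Rfsum K (ekern theta r) <= 2).
  { eapply Rle_trans; [apply Rmult_le_compat_r; eassumption|assumption]. }
  apply (Rmult_le_reg_l (theta / (1 + theta))); [apply Rdiv_lt_0_compat; lra|].
  eapply Rle_trans; [exact H3|]; right; field; lra.
Qed.

Lemma decay_row_summable c theta (A : imat) : 0 < theta ->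
  (forall r s, Cabs (A r s) <= c * (ekern theta r s * ekern theta r s)) ->
  row_summable (c * ekern_mass theta) A.
Proof.
  intros Ht HA r K.
  assert (c0 : 0 <= c).
  { pose proof (HA O O) as H; pose proof (Cabs_ge0 (A O O)).
    unfold ekern, idist in H; rewrite Rminus_diag, Rabs_R0, Rmult_0_r, exp_0 in H; lra. }
  apply Rle_trans with (c * Rfsum K (ekern theta r)).
  - rewrite <- Rfsum_scal; apply Rfsum_le; intros k _.
    eapply Rle_trans; [apply HA|]; apply Rmult_le_compat_l; [assumption|].
    assert (0 < ekern theta r k) by apply exp_pos.
    assert (ekern theta r k <= 1).
    { unfold ekern; rewrite <- exp_0; pose proof (Rabs_pos (INR r - INR k)).
      destruct (Req_dec (idist r k) 0) as [->|Hn]; [rewrite Rmult_0_r; lra|].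
      apply Rlt_le, exp_increasing; unfold idist in *; nra. }
    nra.
  - apply Rmult_le_compat_l; [assumption|]; apply ekern_row_sum, Ht.
Qed.

(** Turns an inequality between path lengths into one between weights; all the weight lemmas reduce
    to it. *)
Lemma exp_weight theta a b d : 0 < theta -> d <= a + b ->
  exp (- theta * a) * exp (- theta * b) <= exp (- theta * d).
Proof.
  intros Ht H; rewrite <- exp_plus.
  destruct (Req_dec (- theta * a + - theta * b) (- theta * d)) as [->|Hn]; [lra|].
  apply Rlt_le, exp_increasing; nra.
Qed.

Lemma pow_exp_cv p kappa gamma : 0 < kappa -> 0 < gamma ->
  Un_cv (fun n => INR n ^ p * exp (- (kappa * Rpower (INR n) gamma))) 0.
Proof.
  intros Hk Hg.
  (* With [j * gamma > p + 1], the bound [exp x >= (x / j)^j] at [x = kappa * n^gamma] already beats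
     [n^(p + 1)] up to the constant [D], so the sequence is at most [D / n]. *)
  destruct (INR_archimed gamma (INR p + 1) Hg) as [j Hj].
  assert (j0 : 0 < INR j).
  { destruct j; [simpl in Hj; pose proof (pos_INR p); lra|apply lt_0_INR; lia]. }
  set (D := (INR j / kappa) ^ j).
  assert (D0 : 0 < D) by (apply pow_lt, Rdiv_lt_0_compat; lra).
  assert (Hb : forall n, (1 <= n)%nat ->
    INR n ^ p * exp (- (kappa * Rpower (INR n) gamma)) <= D * / INR n).
  { intros n Hn; apply le_INR in Hn as Hn'; change (INR 1) with 1 in Hn'.
    set (x := kappa * Rpower (INR n) gamma).
    assert (Hx : 0 < x) by (apply Rmult_lt_0_compat; [|apply exp_pos]; assumption).
    assert (He : (x / INR j) ^ j <= exp x).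
    { replace (exp x) with (exp (x / INR j) ^ j).
      - apply pow_incr; split; [apply Rlt_le, Rdiv_lt_0_compat; assumption|].
        pose proof (exp_ineq1_le (x / INR j)); lra.
      - rewrite <- Rpower_pow by apply exp_pos; unfold Rpower; rewrite ln_exp.
        f_equal; field; lra. }
    assert (Hp : INR n ^ (p + 1) <= D * (x / INR j) ^ j).
    { unfold D, x; rewrite <- Rpow_mult_distr.
      replace (INR j / kappa * _) with (Rpower (INR n) gamma) by (field; lra).
      rewrite <- (Rpower_pow j) by apply exp_pos; rewrite Rpower_mult, <- Rpower_pow by lra.
      apply Rle_Rpower; [lra|]; rewrite plus_INR; simpl; lra. }
    assert (Hxj : 0 < (x / INR j) ^ j) by (apply pow_lt, Rdiv_lt_0_compat; assumption).
    rewrite exp_Ropp.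
    apply (Rmult_le_reg_l (exp x * INR n)); [apply Rmult_lt_0_compat; [apply exp_pos|lra]|].
    replace (exp x * INR n * (INR n ^ p * / exp x)) with (INR n ^ (p + 1)).
    - replace (exp x * INR n * (D * / INR n)) with (D * exp x) by (field; lra).
      eapply Rle_trans; [exact Hp|]; apply Rmult_le_compat_l; lra.
    - rewrite pow_add; simpl; field; apply Rgt_not_eq, exp_pos. }
  intros e He.
  destruct (INR_archimed e D He) as [N HN].
  exists (S N); intros n Hn; unfold Rdist; rewrite Rminus_0_r, Rabs_right.
  - eapply Rle_lt_trans; [apply Hb; lia|].
    assert (INR N < INR n) by (apply lt_INR; lia); pose proof (pos_INR N).
    apply (Rmult_lt_reg_r (INR n)); [lra|].
    replace (D * / INR n * INR n) with D by (field; lra); nra.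
  - apply Rle_ge, Rmult_le_pos; [apply pow_le, pos_INR|apply Rlt_le, exp_pos].
Qed.

(** Half of the decay rate in H(alpha). An entry is then bounded by [c] times the square of [ekern]:
    one factor is summed, the other moves weights. *)
Definition mindecay c' alpha n := c' / (2 * Rpower (INR n) alpha).

Definition exp_gap theta L : R := exp (- theta * (2 * L)).

(** There are [n] diagonal entries, each at most [m^2] (from the induction on the word) times one
    kernel mass per step, times the gain of a closed path of length [2 L]. *)
Definition loc_bound c theta L m n : R :=
  INR n * (INR (m * m) * (c * ekern_mass theta) ^ m * exp_gap theta L).

Definition loc_error c c' alpha beta m n : R :=
  loc_bound c (mindecay c' alpha n) (2 * INR m * Rpower (INR n) beta) m n.

Lemma mindecay_pos c' alpha n : 0 < c' -> 0 < mindecay c' alpha n.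
Proof.
  intros H; apply Rdiv_lt_0_compat; [assumption|].
  apply Rmult_lt_0_compat; [lra|apply exp_pos].
Qed.

Lemma loc_error_cv c c' alpha beta m : 0 < c -> 0 < c' -> 0 < alpha < 1 -> alpha < beta ->
  (1 <= m)%nat -> Un_cv (loc_error c c' alpha beta m) 0.
Proof.
  intros Hc Hc' Ha Hb Hm.
  apply le_INR in Hm as Hm'; change (INR 1) with 1 in Hm'.
  set (E := INR (m * m) * (c * (2 + 4 / c')) ^ m).
  pose proof (pow_exp_cv (Datatypes.S m) (2 * INR m * c') (beta - alpha)
     ltac:(nra) ltac:(lra)) as H.
  pose proof (CV_mult _ _ _ _ (Un_cv_const E) H) as HE; rewrite Rmult_0_r in HE.
  intros e He; destruct (HE e He) as [N HN]; exists (max 1 N); intros n Hn.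
  specialize (HN n ltac:(lia)); unfold Rdist in *; rewrite Rminus_0_r in *.
  assert (Hn1 : (1 <= n)%nat) by lia.
  apply le_INR in Hn1; change (INR 1) with 1 in Hn1.
  pose proof (mindecay_pos c' alpha n Hc') as Ht.
  assert (0 < 2 / mindecay c' alpha n) by (apply Rdiv_lt_0_compat; lra).
  assert (Hl0 : 0 <= loc_error c c' alpha beta m n).
  { unfold loc_error, loc_bound, exp_gap, ekern_mass; repeat apply Rmult_le_pos; try apply pos_INR; [|apply Rlt_le, exp_pos].
    apply pow_le, Rmult_le_pos; lra. }
  rewrite Rabs_right in HN.
  - rewrite Rabs_right by lra; eapply Rle_lt_trans; [|exact HN].
    unfold loc_error, loc_bound, exp_gap, ekern_mass, E.
    assert (Hexp : exp (- mindecay c' alpha n * (2 * (2 * INR m * Rpower (INR n) beta)))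
      = exp (- (2 * INR m * c' * Rpower (INR n) (beta - alpha)))).
    { f_equal; unfold mindecay; replace beta with (beta - alpha + alpha) at 1 by ring.
      rewrite Rpower_plus; field; apply Rgt_not_eq, exp_pos. }
    rewrite Hexp.
    assert (HS : c * (2 + 2 / mindecay c' alpha n) <= c * (2 + 4 / c') * INR n).
    { rewrite Rmult_assoc; apply Rmult_le_compat_l; [lra|].
      replace (2 / mindecay c' alpha n) with (4 / c' * Rpower (INR n) alpha)
        by (unfold mindecay; field; split; [apply Rgt_not_eq, exp_pos|lra]).
      assert (Rpower (INR n) alpha <= INR n).
      { rewrite <- (Rpower_1 (INR n)) at 2 by lra; apply Rle_Rpower; lra. }
      assert (0 < 4 / c') by (apply Rdiv_lt_0_compat; lra); nra. }
    assert (HSm : (c * (2 + 2 / mindecay c' alpha n)) ^ m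
        <= (c * (2 + 4 / c')) ^ m * INR n ^ m).
    { rewrite <- Rpow_mult_distr; apply pow_incr; split; [|assumption].
      apply Rmult_le_pos; lra. }
    set (x := exp _); assert (0 < x) by apply exp_pos.
    replace (INR (m * m) * (c * (2 + 4 / c')) ^ m * (INR n ^ Datatypes.S m * x))
      with (INR n * (INR (m * m) * ((c * (2 + 4 / c')) ^ m * INR n ^ m) * x)) by (simpl; ring).
    apply Rmult_le_compat_l; [lra|]; apply Rmult_le_compat_r; [lra|].
    apply Rmult_le_compat_l; [apply pos_INR|assumption].
  - unfold E; apply Rle_ge; repeat apply Rmult_le_pos; try apply pos_INR; try apply pow_le.
    + assert (0 < 4 / c') by (apply Rdiv_lt_0_compat; lra); apply Rmult_le_pos; lra.
    + apply pos_INR.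
    + apply Rlt_le, exp_pos.
Qed.

Lemma hypH_decay c c' alpha (A : imat) n :
  (forall r s, Cabs (A r s) <= c * exp (- c' * Rabs (INR r - INR s) / Rpower (INR n) alpha)) ->
  forall r s, Cabs (A r s) <=
    c * (ekern (mindecay c' alpha n) r s * ekern (mindecay c' alpha n) r s).
Proof.
  intros H r s; eapply Rle_trans; [apply H|]; right; f_equal.
  unfold ekern; rewrite <- exp_plus; f_equal; unfold mindecay, idist; field.
  apply Rgt_not_eq, exp_pos.
Qed.

Definition inwin (l1 l2 : R) (x : nat) : bool :=
  (Z.leb (Int_part l1 - 1) (Z.of_nat x) && Z.ltb (Z.of_nat x) (Int_part l2 + 1))%bool.

Lemma Pint_diag l1 l2 r s : l1 <= l2 ->
  Pint l1 l2 r s = if (Nat.eqb r s && inwin l1 l2 r)%bool then C1 else C0.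
Proof.
  intros H; unfold Pint, msub, Pz, inwin; destruct (Nat.eqb r s); simpl.
  - assert (Hi : (Int_part l1 - 1 < Int_part l2 + 1)%Z).
    { destruct (base_Int_part l1), (base_Int_part l2).
      apply lt_IZR; rewrite minus_IZR, plus_IZR; simpl; lra. }
    destruct (Z.ltb_spec (Z.of_nat r) (Int_part l2 + 1)),
      (Z.ltb_spec (Z.of_nat r) (Int_part l1 - 1)),
      (Z.leb_spec (Int_part l1 - 1) (Z.of_nat r)); simpl; try lia;
    apply Cx_eq; unfold Csub, Cadd, Copp, C0, C1, Cre, Cim; simpl; ring.
  - apply Cx_eq; unfold Csub, Cadd, Copp, C0, Cre, Cim; simpl; ring.
Qed.

Lemma window_compress l1 l2 X r s : l1 <= l2 ->
  mmul (mmul (Pint l1 l2) X) (Pint l1 l2) r s =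
  if (inwin l1 l2 r && inwin l1 l2 s)%bool then X r s else C0.
Proof.
  intros H.
  rewrite (mmul_diag_r _ (inwin l1 l2)) by (intros; apply Pint_diag, H).
  rewrite (mmul_diag_l _ (inwin l1 l2)) by (intros; apply Pint_diag, H).
  destruct (inwin l1 l2 r), (inwin l1 l2 s); reflexivity.
Qed.

Lemma inwin_bounded l1 l2 x : inwin l1 l2 x = true -> (x < Z.to_nat (Int_part l2 + 1))%nat.
Proof.
  intros H; apply andb_prop in H as [_ H]; apply Z.ltb_lt in H; lia.
Qed.

Lemma outside_window_far n L x :
  inwin (INR n - L) (INR n + L) x = false -> L <= idist x n.
Proof.
  unfold inwin, idist; intros H; apply Bool.andb_false_iff in H as [H|H].
  - apply Z.leb_gt, IZR_lt in H; rewrite minus_IZR, <- INR_IZR_INZ in H.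
    destruct (base_Int_part (INR n - L)).
    rewrite Rabs_minus_sym; eapply Rle_trans; [|apply Rle_abs]; lra.
  - apply Z.ltb_ge, IZR_le in H; rewrite plus_IZR, <- INR_IZR_INZ in H.
    destruct (base_Int_part (INR n + L)).
    eapply Rle_trans; [|apply Rle_abs]; lra.
Qed.

(* [wgtU] and [wgtZ] are only lower bounds for the length of the paths they control: they are what
   is needed to close a path at [s] with total length at least [2 L]. *)
Definition wgtU theta L n s r := exp (- theta * (2 * L - (INR n - INR s) - idist r n)).
Definition wgtV theta n s r := exp (- theta * ((INR n - INR s) + idist r n)).
Definition wgtZ theta L s r := exp (- theta * (2 * L - idist r s)).

Lemma idist_triang r k s : idist r s <= idist r k + idist k s.
Proof.
  unfold idist; replace (INR r - INR s) with ((INR r - INR k) + (INR k - INR s)) by ring.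
  apply Rabs_triang.
Qed.

Lemma idist_sym r k : idist r k = idist k r.
Proof. apply Rabs_minus_sym. Qed.

Lemma idist_le r k : (r <= k)%nat -> idist r k = INR k - INR r.
Proof.
  intros H; apply le_INR in H; rewrite idist_sym; unfold idist; rewrite Rabs_right; lra.
Qed.

Section Weights.
Variables (theta L : R) (n s : nat) (out : nat -> bool).
Hypotheses (theta_pos : 0 < theta) (lt_sn : (s < n)%nat)
  (out_far : forall x, out x = true -> L <= idist x n).

Lemma wgt_YY r k : ekern theta r k * ekern theta k s <= ekern theta r s.
Proof. apply exp_weight; [assumption|apply idist_triang]. Qed.

Lemma wgt_UU r k : ekern theta r k * wgtU theta L n s k <= wgtU theta L n s r.
Proof.
  apply exp_weight; [assumption|].
  pose proof (idist_triang k r n); rewrite (idist_sym k r) in *; lra.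
Qed.

Lemma wgt_YU r k : (out r || out k)%bool = true ->
  ekern theta r k * ekern theta k s <= wgtU theta L n s r.
Proof.
  intros H; apply exp_weight; [assumption|].
  rewrite <- idist_le by lia.
  pose proof (idist_triang r s n); pose proof (idist_triang r k s).
  pose proof (idist_triang k s n); pose proof (idist_triang k r n).
  rewrite (idist_sym k r) in *.
  apply Bool.orb_true_iff in H as [H|H]; apply out_far in H; lra.
Qed.

Lemma wgt_VV r k : ekern theta r k * wgtV theta n s k <= wgtV theta n s r.
Proof. apply exp_weight; [assumption|]; pose proof (idist_triang r k n); lra. Qed.

Lemma wgt_YV k : (n <= k)%nat -> ekern theta k s <= wgtV theta n s k.
Proof.
  intros H; right; unfold ekern, wgtV; do 2 f_equal.
  rewrite (idist_sym k s), (idist_sym k n), !idist_le by lia; ring.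
Qed.

Lemma wgt_ZZ r k : ekern theta r k * wgtZ theta L s k <= wgtZ theta L s r.
Proof.
  apply exp_weight; [assumption|].
  pose proof (idist_triang k r s); rewrite (idist_sym k r) in *; lra.
Qed.

Lemma wgt_UZ k : (n <= k)%nat -> wgtU theta L n s k <= wgtZ theta L s k.
Proof.
  intros H; right; unfold wgtU, wgtZ; do 2 f_equal.
  rewrite (idist_sym k s), (idist_sym k n), !idist_le by lia; ring.
Qed.

Lemma wgt_VZ r k : (out r || out k)%bool = true ->
  ekern theta r k * wgtV theta n s k <= wgtZ theta L s r.
Proof.
  intros H; apply exp_weight; [assumption|].
  rewrite <- idist_le by lia.
  pose proof (idist_triang r s n); pose proof (idist_triang r k n).
  pose proof (idist_triang k r s); pose proof (idist_triang k s n).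
  rewrite (idist_sym k r) in *.
  apply Bool.orb_true_iff in H as [H|H]; apply out_far in H; lra.
Qed.

End Weights.

Definition defect n ls (A : imat) : Cx :=
  Csub (mtrace (prodP A (Pn n) ls)) (mtrace (mmul (mpow A (list_sum ls)) (Pn n))).

Lemma defect_trunc_cv S A n ls : row_summable S A -> ls <> nil ->
  Ccv (fun N => defect n ls (trunc N A)) (defect n ls A).
Proof.
  intros HS Hl; apply Ccv_sub; [apply (mtrace_prodP_cv S); assumption|].
  apply (mtrace_prodP_cv S A n (list_sum ls :: nil)); [assumption|congruence].
Qed.

Lemma Pn_out_l n r s : (n <= r)%nat -> Pn n r s = C0.
Proof.
  intros H; unfold Pn, Pz; replace (Z.of_nat r <? Z.of_nat n)%Z with false.
  - rewrite Bool.andb_false_r; reflexivity.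
  - symmetry; apply Z.ltb_ge; lia.
Qed.

Lemma window_supported l1 l2 X : l1 <= l2 ->
  exists N, supported_in N (mmul (mmul (Pint l1 l2) X) (Pint l1 l2)).
Proof.
  intros H; exists (Z.to_nat (Int_part l2 + 1)); intros r s Hrs.
  rewrite window_compress by assumption.
  destruct (inwin l1 l2 r) eqn:Er, (inwin l1 l2 s) eqn:Es; try reflexivity.
  apply inwin_bounded in Er, Es; simpl; lia.
Qed.

Module FiniteMatrices.
Import all_boot all_order all_algebra sesquilinear spectral complex Rstruct ring zify.
Set Implicit Arguments. Unset Strict Implicit. Unset Printing Implicit Defensive.
Import Order.TTheory GRing.Theory Num.Theory.
Local Open Scope ring_scope.
Local Open Scope sesquilinear_scope.

(** * Trace duality *)

Section TraceDuality.
Context {C : numClosedFieldType}.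

Definition sqnorm n (x : 'cV[C]_n) : C := \sum_i `|x i 0| ^+ 2.

Definition opbound n (L : C) (Z : 'M[C]_n) :=
  forall x : 'cV_n, sqnorm (Z *m x) <= L ^+ 2 * sqnorm x.

Lemma sqnormE n (x : 'cV[C]_n) : sqnorm x = (x^t* *m x) 0 0.
Proof. by rewrite mxE; apply: eq_bigr => i _; rewrite !mxE normCK mulrC. Qed.

Lemma sqnorm_ge0 n (x : 'cV[C]_n) : 0 <= sqnorm x.
Proof. by apply: sumr_ge0 => i _; rewrite exprn_ge0. Qed.

Lemma sqnorm_unitary n (U : 'M[C]_n) x : U \is unitarymx -> sqnorm (U *m x) = sqnorm x.
Proof.
move=> uU; rewrite !sqnormE trmx_mul map_mxM mulmxA -(mulmxA _ _ U).
by rewrite -invmx_unitary // mulVmx ?mulmx1 // unitarymx_unit.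
Qed.

Lemma sqnorm_entry n (x : 'cV[C]_n) i : `|x i 0| ^+ 2 <= sqnorm x.
Proof.
by rewrite /sqnorm (bigD1 i) //= lerDl sumr_ge0 // => j _; rewrite exprn_ge0.
Qed.

Lemma opbound_mul n L1 L2 (Z1 Z2 : 'M[C]_n) :
  0 <= L1 -> 
  opbound L1 Z1 -> opbound L2 Z2 -> opbound (L1 * L2) (Z1 *m Z2).
Proof.
move=> L1_ge0 b1 b2 x; rewrite -mulmxA; apply: le_trans (b1 _) _.
by rewrite exprMn -[leRHS]mulrA; apply: ler_wpM2l; rewrite ?exprn_ge0 ?b2.
Qed.

Lemma opbound1 n : opbound 1 (1%:M : 'M[C]_n).
Proof. by move=> x; rewrite mul1mx expr1n mul1r. Qed.

Lemma spectral_conj n (A : 'M[C]_n) : A^t* = A ->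
  spectralmx A *m A *m (spectralmx A)^t* = diag_mx (spectral_diag A).
Proof.
move=> hA; have /orthomx_spectralP {2}-> : A \is normalmx.
  by apply/normalmxP; rewrite hA.
rewrite -invmx_unitary ?spectral_unitarymx //.
by rewrite !mulmxA mulmxV ?spectral_unit // mul1mx mulmxK // spectral_unit.
Qed.

Lemma quad_diag n (B A : 'M[C]_n) i :
  ((col i (B^t*))^t* *m A *m col i (B^t*)) 0 0 = (B *m A *m B^t*) i i.
Proof.
rewrite !mxE; apply: eq_bigr => j _; rewrite !mxE; congr (_ * _).
by apply: eq_bigr => k _; rewrite !mxE conjCK.
Qed.

Definition psdmx n (Y : 'M[C]_n) :=
  Y^t* = Y /\ forall x : 'cV_n, 0 <= (x^t* *m Y *m x) 0 0.

Lemma psdmx_diag_ge0 n (Y : 'M[C]_n) i : psdmx Y -> 0 <= spectral_diag Y 0 i.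
Proof.
move=> [hY pY]; have := pY (col i ((spectralmx Y)^t*)).
by rewrite quad_diag spectral_conj // mxE eqxx mulr1n.
Qed.

Lemma mxtrace_unitary n (U A : 'M[C]_n) : U \is unitarymx -> \tr (U *m A *m U^t*) = \tr A.
Proof.
move=> uU; rewrite mxtrace_mulC -invmx_unitary //.
by rewrite mulmxA mulVmx ?mul1mx // unitarymx_unit.
Qed.

(* In an orthonormal eigenbasis [e_i] of [Y] one has [|X e_i| = lambda_i], hence
   [|<e_i, Z X e_i>| <= L lambda_i]. *)
Lemma mxtrace_duality n L (Z X Y : 'M[C]_n) : 0 <= L -> opbound L Z ->
  psdmx Y -> Y *m Y = X^t* *m X -> `|\tr (Z *m X)| <= L * \tr Y.
Proof.
move=> L0 bZ pY YY; have [hY _] := pY.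
set U := spectralmx Y; have uU : U \is unitarymx := spectral_unitarymx Y.
have dU := spectral_conj hY; rewrite -/U in dU.
rewrite -(mxtrace_unitary (Z *m X) uU) -(mxtrace_unitary Y uU) dU mxtrace_diag.
rewrite mulr_sumr; apply: le_trans (ler_norm_sum _ _ _) _.
apply: ler_sum => i _; have D0 := psdmx_diag_ge0 i pY.
rewrite -(@ler_pXn2r _ 2) ?nnegrE ?mulr_ge0 //.
have -> : (U *m (Z *m X) *m U^t*) i i = (U *m (Z *m (X *m col i (U^t*)))) i 0.
  by rewrite colE !mulmxA -[_ *m delta_mx i 0]colE [RHS]mxE.
apply: le_trans (sqnorm_entry _ _) _; rewrite sqnorm_unitary //.
apply: le_trans (bZ _) _; rewrite exprMn; apply: ler_wpM2l; first by rewrite exprn_ge0.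
rewrite sqnormE trmx_mul map_mxM -mulmxA (mulmxA _ X) -YY mulmxA quad_diag.
have -> : U *m (Y *m Y) *m U^t* = (U *m Y *m U^t*) *m (U *m Y *m U^t*).
  rewrite -!mulmxA; congr (_ *m (_ *m _)).
  by rewrite !mulmxA -invmx_unitary // mulVmx ?mul1mx ?unitarymx_unit.
by rewrite dU mulmx_diag !mxE eqxx mulr1n expr2.
Qed.

Lemma absmx_exists n (X : 'M[C]_n) :
  exists Y : 'M[C]_n, psdmx Y /\ Y *m Y = X^t* *m X.
Proof.
set S := X^t* *m X; have hS : S^t* = S by rewrite /S trmx_mul map_mxM trmxCK.
set U := spectralmx S; have uU : U \is unitarymx := spectral_unitarymx S.
have dU := spectral_conj hS; rewrite -/U in dU; set D := spectral_diag S in dU.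
have D0 i : 0 <= D 0 i.
  have <- : ((col i (U^t*))^t* *m S *m col i (U^t*)) 0 0 = D 0 i.
    by rewrite quad_diag dU mxE eqxx mulr1n.
  by rewrite mulmxA -map_mxM -trmx_mul -mulmxA -sqnormE sqnorm_ge0.
pose E : 'rV[C]_n := \row_i sqrtC (D 0 i).
have hE : (diag_mx E)^t* = diag_mx E.
  rewrite tr_diag_mx map_diag_mx; congr diag_mx; apply/rowP => i.
  by rewrite !mxE; apply/CrealP/ger0_real; rewrite sqrtC_ge0.
exists (U^t* *m diag_mx E *m U); split; first split.
- by rewrite !trmx_mul !map_mxM trmxCK hE mulmxA.
- move=> x; rewrite !mulmxA -(mulmxA _ U x) -map_mxM -trmx_mul.
  set y := U *m x; rewrite mxE; apply: sumr_ge0 => j _.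
  rewrite mul_mx_diag !mxE mulrAC -normCKC mulr_ge0 ?exprn_ge0 //.
  by rewrite sqrtC_ge0.
- rewrite !mulmxA -(mulmxA _ U (U^t*)) (unitarymxP uU) mulmx1.
  rewrite -(mulmxA _ (diag_mx E) (diag_mx E)) mulmx_diag.
  have -> : (\row_i (E 0 i * E 0 i)) = D.
    by apply/rowP => i; rewrite !mxE -expr2 sqrtCK.
  rewrite -dU -invmx_unitary // !mulmxA mulVmx ?unitarymx_unit // mul1mx.
  by rewrite -mulmxA mulVmx ?unitarymx_unit // mulmx1.
Qed.

End TraceDuality.
(** * Words in a matrix and a projection *)

Section Words.
Context {C : numClosedFieldType} {N : nat}.
Implicit Types (A B : 'M[C]_N) (p : pred 'I_N) (ds : seq bool).

Definition projmx p : 'M[C]_N := diag_mx (\row_i (p i)%:R).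

Definition word p A ds : 'M[C]_N :=
  foldr (fun d X => A *m ((if d then projmx p else 1%:M) *m X)) 1%:M ds.

Lemma projmxE p m (X : 'M_(N, m)) i j : (projmx p *m X) i j = (p i)%:R * X i j.
Proof. by rewrite mul_diag_mx !mxE. Qed.

Lemma mul_projmxE p m (X : 'M_(m, N)) i j : (X *m projmx p) i j = X i j * (p j)%:R.
Proof. by rewrite mul_mx_diag !mxE. Qed.

Lemma opbound_projmx p : opbound 1 (projmx p).
Proof.
move=> x; rewrite expr1n mul1r; apply: ler_sum => i _; rewrite projmxE.
by case: (p i); rewrite ?mul1r ?mul0r // normr0 expr0n exprn_ge0.
Qed.

Lemma opbound_ifproj p (d : bool) : opbound 1 (if d then projmx p else 1%:M).
Proof. by case: d; [exact: opbound_projmx | exact: opbound1]. Qed.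

Lemma opbound_word p A M ds : 0 <= M -> opbound M A ->
  opbound (M ^+ size ds) (word p A ds).
Proof.
move=> M0 bA; elim: ds => [|d ds IH] /=; first exact: opbound1.
rewrite exprS; apply: opbound_mul => //.
by rewrite -[_ ^+ _]mul1r; apply: opbound_mul => //; apply: opbound_ifproj.
Qed.

Lemma trace_word_diff p A B M t ds (R T : 'M_N) r u :
  1 <= M -> opbound M A -> opbound M B ->
  (forall L Z, 0 <= L -> opbound L Z -> `|\tr (Z *m (B - A))| <= L * t) ->
  0 <= r -> opbound r R -> 0 <= u -> opbound u T ->
  `|\tr (R *m word p B ds *m T) - \tr (R *m word p A ds *m T)|
    <= (size ds)%:R * M ^+ size ds * r * u * t.
Proof.
move=> M1 bA bB dual; have M0 : 0 <= M := le_trans ler01 M1.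
have t0 : 0 <= t.
  by have := dual 1 _ ler01 (@opbound1 _ _); rewrite mul1r; apply: le_trans.
elim: ds R r => [|d ds IH] R r r0 bR u0 bT /=.
  by rewrite subrr normr0 !mul0r.
set D := if d then _ else _; set wB := word p B ds; set wA := word p A ds.
have bD : opbound 1 D := opbound_ifproj p d.
rewrite -[X in X - _](subrK (\tr (R *m A *m D *m wB *m T))) -addrA.
apply: le_trans (ler_normD _ _) _; rewrite -addn1 natrD addrC !mulrDl addrC.
have lM : M ^+ size ds <= M ^+ (size ds).+1 by rewrite exprS ler_peMl ?exprn_ge0.
rewrite addn1 [leRHS]addrC; apply: lerD.
  have -> : \tr (R *m (B *m (D *m wB)) *m T) - \tr (R *m A *m D *m wB *m T)
      = \tr ((D *m (wB *m (T *m R))) *m (B - A)).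
    have rot X : \tr (R *m X *m D *m wB *m T) = \tr (D *m (wB *m (T *m R)) *m X).
      by rewrite -!mulmxA mxtrace_mulC -!mulmxA mxtrace_mulC -!mulmxA.
    by rewrite !mulmxA rot (rot A) -linearB /= -mulmxBr !mulmxA.
  apply: le_trans (dual (M ^+ size ds * (u * r)) _ _ _) _.
  - by rewrite !mulr_ge0 ?exprn_ge0.
  - rewrite -[X in opbound X]mul1r; apply: opbound_mul => //.
    apply: opbound_mul; rewrite ?exprn_ge0 //; first exact: opbound_word.
    exact: opbound_mul.
  by rewrite mul1r (mulrC u) mulrA !ler_wpM2r.
have -> : R *m (A *m (D *m wA)) *m T = R *m A *m D *m wA *m T by rewrite !mulmxA.
apply: le_trans (IH (R *m A *m D) (r * M) _ _ u0 bT) _.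
- by rewrite mulr_ge0.
- by rewrite -[X in opbound X]mulr1; apply: opbound_mul; rewrite ?mulr_ge0 //; apply: opbound_mul.
by rewrite exprS (mulrC M) (mulrC r M) !mulrA.
Qed.

End Words.

Section Decay.
Context {C : numClosedFieldType} {N : nat}.
Variables (p o : pred 'I_N) (A A' : 'M[C]_N) (e : 'I_N -> 'I_N -> C) (c S : C) (s : 'I_N).
Variables (wY wU wV wZ : 'I_N -> C).
Hypotheses (c0 : 0 <= c) (S0 : 0 <= S) (e0 : forall r k, 0 <= e r k)
  (sum_e : forall r, \sum_k e r k <= S)
  (leA : forall r k, `|A r k| <= c * (e r k * e r k))
  (defA' : forall r k, A' r k = if o r || o k then 0 else A r k)
  (wY0 : forall r, 0 <= wY r) (wU0 : forall r, 0 <= wU r)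
  (wV0 : forall r, 0 <= wV r) (wZ0 : forall r, 0 <= wZ r)
  (wYs : 1 <= wY s)
  (wYY : forall r k, e r k * wY k <= wY r)
  (wUU : forall r k, e r k * wU k <= wU r)
  (wYU : forall r k, o r || o k -> e r k * wY k <= wU r)
  (wVV : forall r k, e r k * wV k <= wV r)
  (wYV : forall k, ~~ p k -> wY k <= wV k)
  (wZZ : forall r k, e r k * wZ k <= wZ r)
  (wUZ : forall k, ~~ p k -> wU k <= wZ k)
  (wVZ : forall r k, o r || o k -> e r k * wV k <= wZ r).

Lemma kernel_step (M : 'M[C]_N) (x : 'cV[C]_N) K w r v :
  0 <= v -> 0 <= K ->
  (forall k, `|M r k| <= c * (e r k * e r k)) ->
  (forall k, `|x k 0| <= K * w k) ->
  (forall k, M r k != 0 -> e r k * w k <= v) ->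
  `|(M *m x) r 0| <= K * (c * S) * v.
Proof.
move=> v0 K0 leM lex lew; rewrite mxE; apply: le_trans (ler_norm_sum _ _ _) _.
have -> : K * (c * S) * v = K * c * v * S by rewrite mulrA mulrAC.
apply: le_trans (_ : \sum_k K * c * v * e r k <= _); last first.
  by rewrite -mulr_sumr ler_wpM2l ?mulr_ge0.
apply: ler_sum => k _; rewrite normrM.
have [->|nz] := eqVneq (M r k) 0; first by rewrite normr0 mul0r !mulr_ge0.
apply: le_trans (ler_pM _ _ (leM k) (lex k)) _ => //.
have -> : c * (e r k * e r k) * (K * w k) = K * c * e r k * (e r k * w k).
  by ring.
rewrite [leRHS]mulrAC; apply: ler_wpM2l; first by rewrite !mulr_ge0.
exact: lew.
Qed.

Let leA' r k : `|A' r k| <= c * (e r k * e r k).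
Proof. by rewrite defA'; case: ifP => // _; rewrite normr0 !mulr_ge0. Qed.

Let leAA' r k : `|(A - A') r k| <= c * (e r k * e r k).
Proof. by rewrite !mxE defA'; case: ifP; rewrite ?subr0 // subrr normr0 !mulr_ge0. Qed.

Let suppAA' r k : (A - A') r k != 0 -> o r || o k.
Proof. by rewrite !mxE defA'; case: ifP; rewrite ?subrr ?eqxx. Qed.

Let x0 : 'cV[C]_N := delta_mx s 0.
Let Xc M ds := word p M ds *m x0.
Let Yc M (ds : seq bool) := word p M (nseq (size ds) false) *m x0.
Let D (d : bool) : 'M[C]_N := if d then projmx p else 1%:M.

(* For [x = X_A e_s], [y = Y_A e_s], where [Y] is the word without projections, and primes for
   [A'], the weights [wY], [wU], [wV], [wZ] bound [y], [y - y'], [x' - y'] and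
   [(x - x') - (y - y')], i.e. all paths, those leaving the window, those meeting a removed
   site, and those doing both. *)
Lemma word_column_diff ds r :
  `|((word p A ds - word p A' ds) *m x0
     - (word p A (nseq (size ds) false) - word p A' (nseq (size ds) false)) *m x0) r 0|
  <= (size ds ^ 2)%:R * (c * S) ^+ size ds * wZ r.
Proof.
set a := c * S; have a0 : 0 <= a by rewrite mulr_ge0.
have Xcons M d ds' : Xc M (d :: ds') = M *m (D d *m Xc M ds') by rewrite /Xc /= !mulmxA.
have Ycons M d ds' : Yc M (d :: ds') = M *m Yc M ds' by rewrite /Yc /= mul1mx mulmxA.
have subE (x y : 'cV[C]_N) i : (x - y) i 0 = x i 0 - y i 0 by rewrite !mxE.
have addE (x y : 'cV[C]_N) i : (x + y) i 0 = x i 0 + y i 0 by rewrite !mxE.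
have mixE d (x y : 'cV_N) k : (D d *m x - (y - D d *m y)) k 0 =
    if d && ~~ p k then - y k 0 else x k 0.
  rewrite !subE /D; case: d => /=; rewrite ?mul1mx ?subrr ?subr0 //.
  by rewrite !projmxE; case: (p k); rewrite ?mul1r ?mul0r ?subrr ?subr0 ?sub0r.
suff [_ _ _ _] : [/\ forall r, `|Yc A ds r 0| <= a ^+ size ds * wY r,
    forall r, `|Yc A' ds r 0| <= a ^+ size ds * wY r,
    forall r, `|(Yc A ds - Yc A' ds) r 0| <= (size ds)%:R * a ^+ size ds * wU r,
    forall r, `|(Xc A' ds - Yc A' ds) r 0| <= (size ds)%:R * a ^+ size ds * wV r &
    forall r, `|(Xc A ds - Xc A' ds - (Yc A ds - Yc A' ds)) r 0|
       <= (size ds ^ 2)%:R * a ^+ size ds * wZ r].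
  by rewrite !mulmxBl; exact.
elim: ds {r} => [|d ds [bY bY' bU bV bZ]].
  rewrite /Yc /Xc /= !mul1mx subrr; split=> r; rewrite ?subrr ?mxE ?normr0 ?mul0r //.
    rewrite expr0 mul1r andbT; case: eqVneq => [->|_] /=; first by rewrite normr1.
    by rewrite normr0.
  rewrite expr0 mul1r andbT; case: eqVneq => [->|_] /=; first by rewrite normr1.
  by rewrite normr0.
set k := size ds in bY bY' bU bV bZ *; have ak0 : 0 <= a ^+ k by rewrite exprn_ge0.
have bVY q : `|(D d *m (Xc A' ds - Yc A' ds) - (Yc A' ds - D d *m Yc A' ds)) q 0|
    <= k.+1%:R * a ^+ k * wV q.
  rewrite mixE; case: ifP => [/andP[_ nq]|_].
    rewrite normrN; apply: le_trans (bY' q) _; apply: ler_pM => //; last exact: wYV.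
    by rewrite ler_peMl // ler1n.
  by apply: le_trans (bV q) _; rewrite !ler_wpM2r // ler_nat.
have bZU q : `|(D d *m (Xc A ds - Xc A' ds - (Yc A ds - Yc A' ds))
      - ((Yc A ds - Yc A' ds) - D d *m (Yc A ds - Yc A' ds))) q 0|
    <= (k ^ 2 + k)%:R * a ^+ k * wZ q.
  rewrite mixE; case: ifP => [/andP[_ nq]|_].
    rewrite normrN; apply: le_trans (bU q) _; apply: ler_pM => //.
    - by rewrite mulr_ge0.
    - by rewrite ler_wpM2r // ler_nat leq_addl.
    - exact: wUZ.
  by apply: le_trans (bZ q) _; rewrite !ler_wpM2r // ler_nat leq_addr.
rewrite !Ycons !Xcons /= -/k; split=> r.
- by rewrite exprSr; apply: (kernel_step (w := wY)) => // q _.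
- by rewrite exprSr; apply: (kernel_step (w := wY)) => // q _.
- have -> : A *m Yc A ds - A' *m Yc A' ds = A *m (Yc A ds - Yc A' ds) + (A - A') *m Yc A' ds.
    by rewrite mulmxBr mulmxBl addrA subrK.
  rewrite addE; apply: le_trans (ler_normD _ _) _.
  rewrite -[k.+1%:R]natr1 exprSr !mulrDl mul1r mulrA; apply: lerD.
    by apply: (kernel_step (w := wU)) => //; rewrite ?mulr_ge0.
  by apply: (kernel_step (w := wY)) => // q /suppAA'; apply: wYU.
- have -> : A' *m (D d *m Xc A' ds) - A' *m Yc A' ds =
    A' *m (D d *m (Xc A' ds - Yc A' ds) - (Yc A' ds - D d *m Yc A' ds)).
    by rewrite !mulmxBr; apply/colP => i; rewrite !subE; ring.
  by rewrite exprSr mulrA; apply: (kernel_step (w := wV)) => //; rewrite ?mulr_ge0.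
have -> : A *m (D d *m Xc A ds) - A' *m (D d *m Xc A' ds) - (A *m Yc A ds - A' *m Yc A' ds)
   = A *m (D d *m (Xc A ds - Xc A' ds - (Yc A ds - Yc A' ds))
      - ((Yc A ds - Yc A' ds) - D d *m (Yc A ds - Yc A' ds)))
   + (A - A') *m (D d *m (Xc A' ds - Yc A' ds) - (Yc A' ds - D d *m Yc A' ds)).
  by rewrite !(mulmxBr, mulmxBl); apply/colP => i; rewrite !(subE, addE); ring.
rewrite addE; apply: le_trans (ler_normD _ _) _.
have -> : (k.+1 ^ 2 = (k ^ 2 + k) + k.+1)%N by rewrite !expnS !expn0; nia.
rewrite (natrD _ (k ^ 2 + k) k.+1) exprSr 2!mulrDl !mulrA -!(mulrA _ c S); apply: lerD.
  by apply: (kernel_step (w := wZ)) => //; rewrite ?mulr_ge0.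
by apply: (kernel_step (w := wV)) => //; rewrite ?mulr_ge0 // => q /suppAA'; apply: wVZ.
Qed.

End Decay.

Section TraceFromColumns.
Context {C : numClosedFieldType} {N : nat}.

Lemma trace_proj_bound (p : pred 'I_N) (M : 'M[C]_N) b :
  (forall s, p s -> `|M s s| <= b) -> `|\tr (M *m projmx p)| <= #|p|%:R * b.
Proof.
move=> leb; apply: le_trans (ler_norm_sum _ _ _) _.
rewrite mulr_natl -sumr_const [leRHS]big_mkcond /=; apply: ler_sum => s _.
rewrite mul_projmxE; case: (boolP (p s)) => ps.
  by rewrite mulr1 unfold_in ps leb.
by rewrite mulr0 normr0 unfold_in (negbTE ps).
Qed.

End TraceFromColumns.

Section TraceDefect.
Context {C : numClosedFieldType} {N : nat}.
Implicit Types (A B X : 'M[C]_N) (p w : pred 'I_N) (ds : seq bool).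

Definition trace_defect p ds X : C :=
  \tr ((word p X ds - word p X (nseq (size ds) false)) *m projmx p).

Definition compress w X : 'M[C]_N := projmx w *m X *m projmx w.

Lemma compressE w X i j : compress w X i j = if w i && w j then X i j else 0.
Proof.
rewrite /compress mul_projmxE projmxE.
by case: (w i); case: (w j); rewrite ?mul1r ?mul0r ?mulr1 ?mulr0.
Qed.

Lemma projmx_idem p : projmx p *m projmx p = projmx p :> 'M[C]_N.
Proof.
apply/matrixP => i j; rewrite projmxE; case: (boolP (p i)) => pi; first by rewrite mul1r.
by rewrite mul0r !mxE (negbTE pi) mul0rn.
Qed.

Lemma iter_mulmx A X k : iter k (mulmx A) X = iter k (mulmx A) 1%:M *m X.
Proof. by elim: k => [|k IH] /=; rewrite ?mul1mx // IH mulmxA. Qed.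

Lemma word_nseq_cat p A k ds :
  word p A (nseq k false ++ ds) = iter k (mulmx A) 1%:M *m word p A ds.
Proof. by elim: k => [|k IH] /=; rewrite mul1mx // IH mulmxA. Qed.

Lemma word_block p A k ds : word p A (nseq k false ++ true :: ds) =
  iter k (mulmx A) 1%:M *m (A *m projmx p) *m word p A ds.
Proof. by rewrite word_nseq_cat /= !mulmxA. Qed.

Lemma trace_word_true p A k :
  \tr (word p A (nseq k false ++ [:: true]) *m projmx p)
  = \tr (word p A (nseq k.+1 false) *m projmx p).
Proof.
rewrite -addn1 nseqD word_block word_nseq_cat /= !mulmx1.
by rewrite -!mulmxA projmx_idem.
Qed.

Lemma opbound_compress w M X : 0 <= M -> opbound M X -> opbound M (compress w X).
Proof.
move=> M0 bX; rewrite /compress -[M]mulr1; apply: opbound_mul => //; last exact: opbound_projmx.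
by rewrite -[M]mul1r; apply: opbound_mul => //; apply: opbound_projmx.
Qed.

Lemma trace_defect_diff p ds M t A B :
  1 <= M -> opbound M A -> opbound M B ->
  (forall L Z, 0 <= L -> opbound L Z -> `|\tr (Z *m (B - A))| <= L * t) ->
  `|trace_defect p ds B - trace_defect p ds A| <= 2 * (size ds)%:R * M ^+ size ds * t.
Proof.
move=> M1 bA bB dual; rewrite /trace_defect !mulmxBl !linearB /=.
have key es := trace_word_diff p es M1 bA bB dual ler01 (@opbound1 _ N) ler01 (opbound_projmx p).
have := key ds; have := key (nseq (size ds) false).
rewrite size_nseq !mul1mx !mulr1 => k1 k2.
set a := \tr _ in k2 *; set b := \tr _ in k2 *.
set c := \tr _ in k1 *; set d := \tr _ in k1 *.
have -> : a - c - (b - d) = (a - b) - (c - d) by ring.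
apply: le_trans (ler_normB _ _) _; rewrite -!mulrA mulr_natl mulr2n !mulrA.
exact: lerD.
Qed.

Lemma norm_sub_approx (a b a' b' k e1 e2 : C) :
  `|b' - a'| <= k -> `|a - a'| <= e1 -> `|b - b'| <= e2 -> `|b - a| <= k + (e1 + e2).
Proof.
move=> H H1 H2; have -> : b - a = (b' - a') + (- (a - a') + (b - b')) by ring.
apply: le_trans (ler_normD _ _) (lerD H _).
by apply: le_trans (ler_normD _ _) _; rewrite normrN lerD.
Qed.

End TraceDefect.

(** * Infinite matrices as finite ones *)

Section Bridge.
Local Open Scope complex_scope.

Definition toC (z : Cx) : R[i] := Complex (Cre z) (Cim z).
Definition ofC (z : R[i]) : Cx := (complex.Re z, complex.Im z).

Lemma toC_inj : injective toC.
Proof. by move=> [a b] [c d] [/= -> ->]. Qed.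

Lemma ofCK : cancel ofC toC. Proof. by case. Qed.

Lemma toC_add z w : toC (Cadd z w) = toC z + toC w. Proof. by []. Qed.
Lemma toC_sub z w : toC (Csub z w) = toC z - toC w. Proof. by []. Qed.
Lemma toC_mul z w : toC (Cmul z w) = toC z * toC w. Proof. by []. Qed.
Lemma toC_conj z : toC (Cconj z) = Num.conj (toC z). Proof. by []. Qed.
Lemma toC0 : toC C0 = 0. Proof. by []. Qed.
Lemma toC_abs z : `|toC z| = (Cabs z)%:C.
Proof. by rewrite normc_def /Cabs RsqrtE !RpowE. Qed.

Lemma toC_abs_sqr z : (pow (Cabs z) 2)%:C = `|toC z| ^+ 2.
Proof. by rewrite toC_abs -rmorphXn RpowE. Qed.

Lemma toC_sum N f : toC (Cfsum N f) = \sum_(k < N) toC (f k).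
Proof. by elim: N => [|N IH]; rewrite ?big_ord0 // big_ord_recr /= toC_add IH. Qed.

Lemma Rfsum_sum N f : Rfsum N f = \sum_(k < N) f k.
Proof. by elim: N => [|N IH]; rewrite ?big_ord0 // big_ord_recr /= IH. Qed.

Lemma lecRP (x y : R) : Rle x y <-> (x%:C <= y%:C).
Proof. by rewrite lecR; split=> /RleP. Qed.

Definition toM N (X : imat) : 'M[R[i]]_N := \matrix_(i, j) toC (X i j).

Lemma toM_mmul N (X Y : imat) :
  (forall r k s, (N <= k)%N -> Cmul (X r k) (Y k s) = C0) ->
  toM N (mmul X Y) = toM N X *m toM N Y.
Proof.
move=> H; apply/matrixP => i j; rewrite !mxE /mmul (Csum_finite N) ?toC_sum.
  by apply: eq_bigr => k _; rewrite !mxE toC_mul.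
by move=> k /ssrnat.leP; apply: H.
Qed.

Lemma toM_diag N (W : imat) (w : nat -> bool) :
  (forall r s, W r s = if (Nat.eqb r s && w r)%bool then C1 else C0) ->
  toM N W = projmx (fun i : 'I_N => w i).
Proof.
move=> HW; apply/matrixP => i j; rewrite !mxE HW.
have -> : Nat.eqb i j = (i == j) by apply/Nat.eqb_spec/eqP => [/val_inj|->].
by case: eqP => //= _; case: (w i).
Qed.

Lemma op_norm_opbound N A (M : R) : op_norm_le A M -> opbound `|M|%:C (toM N A).
Proof.
move=> H x; have := H N N (fun k => if insub k is Some i then ofC (x i 0) else C0).
rewrite !Rfsum_sum RmultE RpowE => /lecRP.
rewrite rmorphM rmorphXn !rmorph_sum /sqnorm.
have -> : (`|M|%:C : R[i]) ^+ 2 = M%:C ^+ 2.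
  by rewrite -!rmorphXn /= real_normK // num_real.
congr (_ <= _ * _); apply: eq_bigr => i _; (etransitivity; first exact: toC_abs_sqr).
  rewrite toC_sum mxE; congr (`|_| ^+ 2); apply: eq_bigr => k _.
  by rewrite toC_mul mxE valK ofCK.
by rewrite valK ofCK.
Qed.

Lemma Cconj_C0 : Cconj C0 = C0.
Proof. by apply: toC_inj; rewrite toC_conj toC0 rmorph0. Qed.

Lemma is_absval_widen N N' X Y : (N <= N')%coq_nat -> supported_in N X ->
  is_absval N X Y -> is_absval N' X Y /\
  Cfsum N' (fun r => Y r r) = Cfsum N (fun r => Y r r).
Proof.
move=> le sX [sY [[hY pY] sq]].
have sY' : supported_in N' Y by move=> r s rs; apply: sY; lia.
split; last by apply: Cfsum_widen => // k Hk; apply: sY; left.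
have cut x : Cfsum N' (fun r => Cfsum N' (fun s => Cmul (Cconj (x r)) (Cmul (Y r s) (x s))))
   = Cfsum N (fun r => Cfsum N (fun s => Cmul (Cconj (x r)) (Cmul (Y r s) (x s)))).
  rewrite (Cfsum_widen N) //.
    apply: Cfsum_ext => r _; apply: Cfsum_widen => // s Hs.
    by rewrite sY ?Cmul_0_l ?Cmul_0_r //; right.
  move=> r Hr; apply: Cfsum_0 => s _.
  by rewrite sY ?Cmul_0_l ?Cmul_0_r //; left.
split=> //; split; first by split=> // x; rewrite cut.
move=> r s _ _.
rewrite !(Cfsum_widen N) //.
- case: (Nat.lt_ge_cases r N) => Hr; last first.
    rewrite !Cfsum_0 // => k _; first by rewrite (sX k r) ?Cconj_C0 ?Cmul_0_l //; right.
    by rewrite (sY r k) ?Cmul_0_l //; left.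
  case: (Nat.lt_ge_cases s N) => Hs; first exact: sq.
  rewrite !Cfsum_0 // => k _; first by rewrite (sX k s) ?Cmul_0_r //; right.
  by rewrite (sY k s) ?Cmul_0_r //; right.
- by move=> k Hk; rewrite (sX k s) ?Cmul_0_r //; left.
- by move=> k Hk; rewrite (sY k s) ?Cmul_0_r //; left.
Qed.

End Bridge.

Section TraceNorm.
Local Open Scope complex_scope.

Lemma toC_quadratic N (Y : imat) (x : nat -> Cx) (v : 'cV[R[i]]_N) :
  (forall i : 'I_N, v i 0 = toC (x i)) ->
  toC (Cfsum N (fun r => Cfsum N (fun s => Cmul (Cconj (x r)) (Cmul (Y r s) (x s)))))
  = (v^t* *m toM N Y *m v) 0 0.
Proof.
move=> vx; rewrite -mulmxA mxE toC_sum; apply: eq_bigr => r _.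
rewrite !mxE vx toC_sum mulr_sumr; apply: eq_bigr => s _.
by rewrite !mxE vx !toC_mul toC_conj.
Qed.

Lemma Creal_herm_quadratic N (Y : 'M[R[i]]_N) (v : 'cV_N) : Y^t* = Y ->
  (v^t* *m Y *m v) 0 0 \is Num.real.
Proof.
move=> hY; apply/CrealP; have -> : ((v^t* *m Y *m v) 0 0)^*%R = ((v^t* *m Y *m v)^t*) 0 0.
  by rewrite !mxE.
by rewrite !trmx_mul !map_mxM trmxCK hY mulmxA.
Qed.

Lemma is_absval_toM N X Y : is_absval N X Y ->
  psdmx (toM N Y) /\ toM N Y *m toM N Y = (toM N X)^t* *m toM N X.
Proof.
move=> [sY [[hY pY] sq]].
have hM : (toM N Y)^t* = toM N Y.
  by apply/matrixP => i j; rewrite !mxE hY toC_conj conjCK.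
split; first split=> // v.
  pose x k := if insub k is Some i then ofC (v i 0) else C0.
  have vx (i : 'I_N) : v i 0 = toC (x i) by rewrite /x valK ofCK.
  rewrite -(RRe_real (Creal_herm_quadratic v hM)) -(toC_quadratic Y vx) ler0c.
  exact/RleP/pY.
apply/matrixP => i j; rewrite !mxE.
have := congr1 toC (sq i j (ssrnat.ltP (ltn_ord i)) (ssrnat.ltP (ltn_ord j))).
rewrite !toC_sum => E; transitivity (\sum_(k < N) toC (Cmul (Y i k) (Y k j))).
  by apply: eq_bigr => k _; rewrite !mxE toC_mul.
by rewrite E; apply: eq_bigr => k _; rewrite !mxE toC_mul toC_conj.
Qed.

Definition ofM N (M : 'M[R[i]]_N) : imat := fun r s =>
  if insub r is Some i then if insub s is Some j then ofC (M i j) else C0 else C0.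

Lemma ofME N (M : 'M[R[i]]_N) (i j : 'I_N) : toC (ofM M i j) = M i j.
Proof. by rewrite /ofM !valK ofCK. Qed.

Lemma ofMK N (M : 'M[R[i]]_N) : toM N (ofM M) = M.
Proof. by apply/matrixP => i j; rewrite mxE ofME. Qed.

Lemma is_absval_ofM N X (M : 'M[R[i]]_N) : psdmx M ->
  M *m M = (toM N X)^t* *m toM N X -> is_absval N X (ofM M).
Proof.
move=> [hM pM] sq; split; last split; first 2 last.
- move=> r s /ssrnat.ltP Hr /ssrnat.ltP Hs; apply: toC_inj; rewrite !toC_sum.
  have := congr1 (fun Z : 'M_N => Z (Ordinal Hr) (Ordinal Hs)) sq; rewrite !mxE => E.
  transitivity (\sum_k M (Ordinal Hr) k * M k (Ordinal Hs)).
    by apply: eq_bigr => k _; rewrite toC_mul -(ofME M (Ordinal Hr)) -(ofME M k).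
  by rewrite E; apply: eq_bigr => k _; rewrite !mxE toC_mul toC_conj.
- move=> r s [] /ssrnat.leP H; rewrite /ofM; first by rewrite insubF // ltnNge H.
  by case: insub => // i; rewrite insubF // ltnNge H.
split=> [r s|x].
  rewrite /ofM; case: insub => [i|]; case: insub => [j|] //; rewrite ?Cconj_C0 //.
  by apply: toC_inj; rewrite toC_conj !ofCK -{1}hM !mxE.
pose v : 'cV_N := \col_i toC (x i).
have vx (i : 'I_N) : v i 0 = toC (x i) by rewrite mxE.
have := pM v; rewrite -{1}(ofMK M) -(toC_quadratic _ vx) => H0.
by apply/RleP; rewrite -ler0c; move: H0; rewrite !lecE => /andP[_ ->]; rewrite eqxx.
Qed.

Lemma trace_toM_real N Y : psdmx (toM N Y) ->
  \tr (toM N Y) = (Cre (Cfsum N (fun r => Y r r)))%:C.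
Proof.
move=> [hY _].
have E : \tr (toM N Y) = toC (Cfsum N (fun r => Y r r)).
  by rewrite toC_sum; apply: eq_bigr => i _; rewrite mxE.
have : \tr (toM N Y) \is Num.real.
  by apply/CrealP; rewrite -[in RHS]hY /mxtrace rmorph_sum; apply: eq_bigr => i _; rewrite !mxE.
by move=> /RRe_real <-; rewrite E.
Qed.

Lemma trace_norm_absval N0 X : supported_in N0 X -> exists N1, forall N, (N1 <= N)%N ->
  exists Y : 'M_N, [/\ psdmx Y, Y *m Y = (toM N X)^t* *m toM N X
                     & \tr Y = (trace_norm X)%:C].
Proof.
move=> sX; rewrite /trace_norm /Rpick.
case: excluded_middle_informative => [ex|nex]; last first.
  case: nex; have [M [pM sq]] := absmx_exists (toM N0 X).
  by eexists; exists N0, (ofM M); split=> //; split=> //; apply: is_absval_ofM.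
case: constructive_indefinite_description => t /= [N1 [Y [sX1 [absY ->]]]].
exists N1 => N /ssrnat.leP le; have [absY' <-] := is_absval_widen le sX1 absY.
have [pY sq] := is_absval_toM absY'.
by exists (toM N Y); split=> //; rewrite trace_toM_real.
Qed.

Lemma trace_norm_duality N0 X : supported_in N0 X -> exists N1, forall N, (N1 <= N)%N ->
  forall L (Z : 'M_N), 0 <= L -> opbound L Z ->
  `|\tr (Z *m toM N X)| <= L * (trace_norm X)%:C.
Proof.
move=> /trace_norm_absval [N1 H]; exists N1 => N /H [Y [pY sq <-]] L Z L0 bZ.
exact: mxtrace_duality.
Qed.

End TraceNorm.

Section Localization.
Local Open Scope complex_scope.

Lemma card_lt_ord N n : (#|[pred i : 'I_N | (i < n)%N]| <= n)%N.
Proof.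
rewrite cardE -(size_map val) -[leqRHS](size_iota 0 n); apply: uniq_leq_size.
  by rewrite map_inj_uniq ?enum_uniq //; apply: val_inj.
move=> x Hx; have [i Hi ->] := elimT mapP Hx.
by move: Hi; rewrite mem_enum inE => lt; rewrite mem_iota add0n.
Qed.

Lemma loc_trace_bound N n ds (theta L c : R) (A : imat) (w : nat -> bool) (p : pred 'I_N) :
  Rlt 0 theta -> (forall i : 'I_N, p i = (i < n)%N) ->
  (forall x, w x = false -> Rle L (idist x n)) ->
  (forall r s, Rle (Cabs (A r s)) (Rmult c (Rmult (ekern theta r s) (ekern theta r s)))) ->
  `|trace_defect p ds (toM N A) - trace_defect p ds (compress (fun i : 'I_N => w i) (toM N A))| <= n%:R *
     ((size ds ^ 2)%:R * (c * ekern_mass theta)%:C ^+ size ds * (exp_gap theta L)%:C).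
Proof.
move=> th0 pE far leA.
have ex0 x : 0 <= (exp x)%:C :> R[i] by rewrite ler0c; apply/RleP/Rlt_le/exp_pos.
have th0' : 0 < theta by apply/RltP.
have c0 : 0 <= c.
  have e1 : ekern theta 0 0 = 1 by rewrite /ekern /idist Rminus_diag Rabs_R0 Rmult_0_r exp_0.
  have := Rle_trans _ _ _ (Cabs_ge0 _) (leA 0%N 0%N); rewrite e1 !RmultE !mulr1.
  by move/RleP.
have S0 : 0 <= ekern_mass theta.
  by apply/RleP; have /= := ekern_row_sum theta 0%N 0%N th0.
rewrite /trace_defect -linearB /= -mulmxBl.
have card_p : (#|p| <= n)%N.
  by rewrite (eq_card (B := [pred i : 'I_N | (i < n)%N])) ?card_lt_ord.
set b := (X in _ <= _ * X).
have gap0 : 0 <= (exp_gap theta L)%:C :> R[i] by apply: ex0.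
have b0 : 0 <= b by rewrite !mulr_ge0 ?ler0n ?exprn_ge0 // ler0c mulr_ge0.
apply: le_trans (_ : #|p|%:R * b <= _); last by rewrite ler_wpM2r // ler_nat.
apply: trace_proj_bound => s; rewrite pE => /ssrnat.ltP lt_sn.
have far' x : ~~ w x = true -> Rle L (idist x n) by move=> /negbTE; apply: far.
have -> : b = (size ds ^ 2)%:R * (c%:C * (ekern_mass theta)%:C) ^+ size ds
     * (wgtZ theta L s s)%:C.
  by rewrite -rmorphM /b /exp_gap /wgtZ /idist Rminus_diag Rabs_R0 Rminus_0_r.
have -> (Z1 Z2 Z3 Z4 : 'M[R[i]]_N) : (Z1 - Z2 - (Z3 - Z4)) s s =
    ((Z1 - Z3) *m delta_mx s 0 - (Z2 - Z4) *m delta_mx s (0 : 'I_1)) s 0.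
  by rewrite -!colE !mxE; ring.
have rC (x y z : R) : Rle (Rmult x y) z -> (x%:C * y%:C <= z%:C :> R[i]).
  by move=> H; rewrite -rmorphM lecR; apply/RleP.
apply: (@word_column_diff _ N p (fun i => ~~ w i) (toM N A) (compress (fun i : 'I_N => w i) (toM N A))
  (fun r k => (ekern theta r k)%:C) c%:C (ekern_mass theta)%:C s
  (fun r => (ekern theta r s)%:C) (fun r => (wgtU theta L n s r)%:C)
  (fun r => (wgtV theta n s r)%:C) (fun r => (wgtZ theta L s r)%:C)) => //=.
- by rewrite ler0c.
- by rewrite ler0c.
- by move=> r k; apply: ex0.
- move=> r; have H := ekern_row_sum theta r N th0; rewrite Rfsum_sum in H.
  by have := (lecRP _ _).1 H; rewrite rmorph_sum.

- by move=> r k; rewrite mxE toC_abs -!rmorphM lecR; apply/RleP.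
- move=> r k; rewrite compressE.
  by case: (w r); case: (w k); rewrite ?mul1r ?mul0r ?mulr1 ?mulr0.
- by move=> r; apply: ex0.
- by move=> r; apply: ex0.
- by move=> r; apply: ex0.
- by move=> r; apply: ex0.
- by rewrite /ekern /idist Rminus_diag Rabs_R0 Rmult_0_r exp_0.
- by move=> r k; apply/rC/wgt_YY.
- by move=> r k; apply/rC/wgt_UU.
- by move=> r k o; apply/rC; exact: (wgt_YU _ _ _ _ (fun x => ~~ w x) th0 lt_sn far' _ _ o).
- by move=> r k; apply/rC/wgt_VV.
- by move=> k; rewrite pE -leqNgt lecR => /ssrnat.leP lk; apply/RleP/wgt_YV.
- by move=> r k; apply/rC/wgt_ZZ.
- by move=> k; rewrite pE -leqNgt lecR => /ssrnat.leP lk; apply/RleP/wgt_UZ.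
- by move=> r k o; apply/rC; exact: (wgt_VZ _ _ _ _ (fun x => ~~ w x) th0 lt_sn far' _ _ o).
Qed.

Lemma loc_boundE c theta L m n : (loc_bound c theta L m n)%:C =
  n%:R * ((m ^ 2)%:R * (c * ekern_mass theta)%:C ^+ m * (exp_gap theta L)%:C) :> R[i].
Proof.
rewrite /loc_bound !RmultE RpowE !INRE -mulnn.
by rewrite -(rmorph_nat (real_complex R)) -(rmorph_nat (real_complex R) (_ * _)) -rmorphXn -!rmorphM.
Qed.

End Localization.

Section FiniteDefect.
Local Open Scope complex_scope.

Definition flags (ls : seq nat) : seq bool :=
  foldr (fun l acc => nseq l.-1 false ++ true :: acc) [::] ls.

Lemma size_flags ls : List.Forall (fun l => (1 <= l)%coq_nat) ls ->
  size (flags ls) = list_sum ls.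
Proof.
by elim=> //= l {}ls l1 _ IH; rewrite size_cat size_nseq /= IH; lia.
Qed.

Lemma toM_trunc N A : toM N (trunc N A) = toM N A.
Proof.
by apply/matrixP => i j; rewrite !mxE trunc_in //; apply/ssrnat.ltP; apply: ltn_ord.
Qed.

Lemma toM_mpow N A l : toM N (mpow (trunc N A) l) = iter l (mulmx (toM N A)) 1%:M.
Proof.
elim: l => [|l IH] /=.
  by apply/matrixP => i j; rewrite !mxE /mid -val_eqE /=; case: PeanoNat.Nat.eqb_spec; case: eqP.
rewrite toM_mmul ?toM_trunc ?IH // => r k s /ssrnat.leP lt.
by rewrite trunc_out_r // Cmul_0_l.
Qed.

Definition below N n : pred 'I_N := fun i => Z.ltb (Z.of_nat i) (Z.of_nat n).

Lemma belowE N n (i : 'I_N) : below n i = (i < n)%N.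
Proof. by rewrite /below; apply/Z.ltb_spec0/idP; lia. Qed.

Lemma toM_Pn N n : toM N (Pn n) = projmx (@below N n).
Proof. by apply: (@toM_diag N _ (fun r => Z.ltb (Z.of_nat r) (Z.of_nat n))). Qed.

Lemma toM_mpow_Pn N n A l : (n <= N)%N -> (1 <= l)%N ->
  toM N (mmul (mpow (trunc N A) l) (Pn n)) =
  iter l.-1 (mulmx (toM N A)) 1%:M *m (toM N A *m projmx (@below N n)).
Proof.
move=> nN l1; rewrite toM_mmul ?toM_Pn ?toM_mpow.
  by rewrite -{1}(prednK l1) iterSr mulmx1 iter_mulmx mulmxA.
by move=> r k s /ssrnat.leP Nk; rewrite Pn_out_l ?Cmul_0_r //; lia.
Qed.

Lemma toM_prodP N n A ls : (n <= N)%N -> List.Forall (fun l => (1 <= l)%coq_nat) ls ->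
  toM N (prodP (trunc N A) (Pn n) ls) = word (@below N n) (toM N A) (flags ls).
Proof.
move=> nN; elim=> [|l {}ls /ssrnat.leP l1 _ IH].
  exact: (toM_mpow N A 0).
rewrite [flags _]/= word_block -IH -toM_mpow_Pn //.
case: ls IH => [|l' ls] IH; first by rewrite IH mulmx1.
rewrite -[prodP _ _ _]/(mmul (mmul (mpow _ l) _) (prodP (trunc N A) (Pn n) (l' :: ls))).
rewrite toM_mmul // => r k s /ssrnat.leP Nk.
rewrite mmul_Pn; case: PeanoNat.Nat.ltb_spec => [H|_]; last exact: Cmul_0_l.
by exfalso; lia.
Qed.

Lemma trace_prodP N n A ls : (n <= N)%N -> ls <> [::] ->
  List.Forall (fun l => (1 <= l)%coq_nat) ls ->
  toC (mtrace (prodP (trunc N A) (Pn n) ls))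
  = \tr (word (@below N n) (toM N A) (flags ls) *m projmx (@below N n)).
Proof.
move=> nN ls0 lsP; rewrite (mtrace_prodP _ _ _ N) //; last exact/ssrnat.leP.
rewrite -toM_prodP // toC_sum; apply: eq_bigr => i _.
rewrite mul_projmxE mxE belowE; case: ltnP => [_|ni]; first by rewrite mulr1.
by rewrite prodP_out // ?mulr0 //; apply/ssrnat.leP.
Qed.

Lemma defect_trunc N n A ls : (n <= N)%N -> ls <> [::] ->
  List.Forall (fun l => (1 <= l)%coq_nat) ls ->
  toC (defect n ls (trunc N A)) = trace_defect (@below N n) (flags ls) (toM N A).
Proof.
move=> nN ls0 lsP; rewrite /defect toC_sub trace_prodP // /trace_defect mulmxBl linearB /=.
congr (_ - _).
have m1 : (1 <= list_sum ls)%N by case: lsP ls0 => //= l ls' l1 _ _; lia.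
have -> : mmul (mpow (trunc N A) (list_sum ls)) (Pn n)
   = prodP (trunc N A) (Pn n) [:: list_sum ls] by [].
rewrite trace_prodP //; last by constructor; [exact/ssrnat.leP | constructor].
by rewrite size_flags // -[in RHS](prednK m1) -trace_word_true.
Qed.

Lemma real_boundE m (M t x y : R) :
  (Rplus (Rmult (Rmult (INR (2 * m)) (pow M m)) t) (Rplus x y))%:C
  = 2 * m%:R * M%:C ^+ m * t%:C + (x%:C + y%:C) :> R[i].
Proof.
rewrite !RplusE !RmultE RpowE INRE -natrM -(rmorph_nat (real_complex R)).
by rewrite -(rmorphXn (real_complex R)) -!(rmorphM (real_complex R)) -!(rmorphD (real_complex R)).
Qed.

Lemma defect_bound_finite n L ls (A B : imat) (M cA thA cB thB : R) :
  Rle 0 L -> Rle 1 M -> op_norm_le A M -> op_norm_le B M -> Rlt 0 thA -> Rlt 0 thB ->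
  (forall r s, Rle (Cabs (A r s)) (Rmult cA (Rmult (ekern thA r s) (ekern thA r s)))) ->
  (forall r s, Rle (Cabs (B r s)) (Rmult cB (Rmult (ekern thB r s) (ekern thB r s)))) ->
  ls <> [::] -> List.Forall (fun l => (1 <= l)%coq_nat) ls ->
  let W := Pint (Rminus (INR n) L) (Rplus (INR n) L) in
  let m := list_sum ls in
  exists N1, forall N, (N1 <= N)%coq_nat ->
  Rle (Cabs (Csub (defect n ls (trunc N B)) (defect n ls (trunc N A))))
    (Rplus (Rmult (Rmult (INR (2 * m)) (pow M m)) (trace_norm (mmul (mmul W (msub B A)) W)))
       (Rplus (loc_bound cA thA L m n) (loc_bound cB thB L m n))).
Proof.
move=> L0 M1 bA bB thA0 thB0 dA dB ls0 lsP W m.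
set X := mmul _ _; set w := inwin (Rminus (INR n) L) (Rplus (INR n) L).
have le12 : Rle (Rminus (INR n) L) (Rplus (INR n) L) by lra.
have XE r s : X r s = if (w r && w s)%bool then msub B A r s else C0.
  exact: window_compress.
have [N0 sX] := window_supported _ _ (msub B A) le12.
have [N1 dual] := trace_norm_duality sX; rewrite -/W -/X in dual.
exists (maxn N1 n) => N /ssrnat.leP; rewrite geq_max => /andP[leN1 nN].
apply/lecRP; rewrite -toC_abs toC_sub !defect_trunc //.
pose w' : pred 'I_N := fun i => w i.
set p := below n; set ds := flags ls; set F := trace_defect p ds.
set An := toM N A; set Bn := toM N B.
have sz : size ds = m by apply: size_flags.
have M1' : 1 <= (M%:C : R[i]) by rewrite -[1]/(1%:C) lecR; apply/RleP.
have bnd Z : op_norm_le Z M -> opbound M%:C (toM N Z).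
  move=> /(@op_norm_opbound N); rewrite ger0_norm //.
  by apply/RleP; apply: Rle_trans Rle_0_1 M1.
have far x : w x = false -> Rle L (idist x n) by apply: outside_window_far.
have locb c th (Z : imat) : Rlt 0 th ->
   (forall r s, Rle (Cabs (Z r s)) (Rmult c (Rmult (ekern th r s) (ekern th r s)))) ->
   `|F (toM N Z) - F (compress w' (toM N Z))| <= (loc_bound c th L m n)%:C.
  move=> th0 dZ; apply: le_trans (loc_trace_bound ds th0 (@belowE N n) far dZ) _.
  by rewrite sz loc_boundE.
have main : `|F (compress w' Bn) - F (compress w' An)|
    <= 2 * m%:R * M%:C ^+ m * (trace_norm X)%:C.
  rewrite -sz; apply: trace_defect_diff => //.
  - by apply: opbound_compress; [apply: le_trans M1' | apply: bnd].
  - by apply: opbound_compress; [apply: le_trans M1' | apply: bnd].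
  move=> K Z K0 bZ; have := dual N leN1 K Z K0 bZ.
  suff -> : toM N X = compress w' Bn - compress w' An by [].
  apply/matrixP => i j; rewrite [RHS]mxE [X in _ = _ + X]mxE !compressE !mxE XE.
  by case: ifP; rewrite ?subr0.
rewrite real_boundE.
exact: (norm_sub_approx main (locb _ _ _ thA0 dA) (locb _ _ _ thB0 dB)).
Qed.

End FiniteDefect.

End FiniteMatrices.

(** * The cumulants *)

Lemma op_norm_le_weaken A M M' : Rabs M <= M' -> op_norm_le A M -> op_norm_le A M'.
Proof.
  intros H HA N K x; eapply Rle_trans; [apply HA|]; apply Rmult_le_compat_r.
  - clear; induction N; cbn [Rfsum]; [lra|]; pose proof (pow2_ge_0 (Cabs (x N))); lra.
  - rewrite <- (pow2_abs M); apply pow_incr; split; [apply Rabs_pos|assumption].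
Qed.

Lemma compositions_spec j m ls : In ls (compositions j m) ->
  Forall (fun l => (1 <= l)%nat) ls /\ list_sum ls = m.
Proof.
  revert m ls; induction j as [|j IH]; intros m ls; simpl.
  - destruct (Nat.eqb_spec m 0) as [->|]; simpl; [|tauto].
    intros [<-|[]]; split; [constructor|reflexivity].
  - intros H; apply in_flat_map in H as [l [Hl H]].
    apply in_map_iff in H as [ls' [<- H]]; apply in_seq in Hl.
    apply IH in H as [H1 H2]; split; [constructor; [lia|assumption]|simpl; lia].
Qed.

Lemma Cabs_Csub_scale a z w :
  Cabs (Csub (Cscale a z) (Cscale a w)) = Rabs a * Cabs (Csub z w).
Proof.
  rewrite <- Cabs_scale; f_equal.
  apply Cx_eq; unfold Csub, Cadd, Copp, Cscale, Cre, Cim; simpl; ring.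
Qed.

Lemma Cbigsum_diff {T : Type} (f g : T -> Cx) (c : T -> R) X s :
  (forall x, In x s -> Cabs (Csub (f x) (g x)) <= c x * X) ->
  Cabs (Csub (Cbigsum f s) (Cbigsum g s)) <= fold_right Rplus 0 (map c s) * X.
Proof.
  unfold Cbigsum; induction s as [|x s IH]; simpl; intros H.
  - replace (Csub C0 C0) with C0 by
      (apply Cx_eq; unfold Csub, Cadd, Copp, C0, Cre, Cim; simpl; ring).
    rewrite Cabs_C0; lra.
  - match goal with |- Cabs (Csub (Cadd ?a ?b) (Cadd ?c ?d)) <= _ =>
      replace (Csub (Cadd a b) (Cadd c d)) with (Cadd (Csub a c) (Csub b d)) by
      (apply Cx_eq; unfold Csub, Cadd, Copp, Cre, Cim; simpl; ring) end.
    eapply Rle_trans; [apply Cabs_triang|]; rewrite Rmult_plus_distr_r.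
    apply Rplus_le_compat; [apply H|apply IH; intros; apply H]; tauto.
Qed.

Definition cumulant_weight (m : nat) : R :=
  fold_right Rplus 0 (map (fun j => Rabs ((-1) ^ (j + 1) / INR j) *
    fold_right Rplus 0 (map (fun ls => Rabs (/ INR (factprod ls))) (compositions j m)))
    (seq 1 m)).

Lemma cumulant_diff m n A B X :
  (forall ls, Forall (fun l => (1 <= l)%nat) ls -> list_sum ls = m ->
     Cabs (Csub (defect n ls B) (defect n ls A)) <= X) ->
  Cabs (Csub (cumulant m n B) (cumulant m n A)) <= cumulant_weight m * X.
Proof.
  intros H; apply Cbigsum_diff; intros j _.
  rewrite Cabs_Csub_scale, Rmult_assoc; apply Rmult_le_compat_l; [apply Rabs_pos|].
  apply Cbigsum_diff; intros ls Hls; apply compositions_spec in Hls as [H1 H2].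
  rewrite Cabs_Csub_scale; apply Rmult_le_compat_l; [apply Rabs_pos|].
  specialize (H ls H1 H2); unfold defect in H; rewrite H2 in H; exact H.
Qed.

Theorem theorem3p1 (alpha : R) (A B : nat -> imat) :
  0 < alpha < 1 -> hypH alpha A -> hypH alpha B ->
  forall (beta : R) (m : nat), alpha < beta -> (2 <= m)%nat ->
  exists (K : R) (eps : nat -> R),
    Un_cv eps 0 /\
    forall n : nat, (1 <= n)%nat ->
      Cabs (Csub (cumulant m n (B n)) (cumulant m n (A n)))
      <= K * trace_norm (mmul (mmul (Pwin m beta n) (msub (B n) (A n))) (Pwin m beta n))
         + eps n.
Proof.
  intros Ha [[MA HMA] [cA [cA' [HcA [HcA' HA]]]]] [[MB HMB] [cB [cB' [HcB [HcB' HB]]]]]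
    beta m Hb Hm.
  set (M := 1 + Rabs MA + Rabs MB).
  pose proof (Rabs_pos MA); pose proof (Rabs_pos MB).
  exists (cumulant_weight m * (INR (2 * m) * M ^ m)),
    (fun n => cumulant_weight m *
       (loc_error cA cA' alpha beta m n + loc_error cB cB' alpha beta m n)).
  split.
  - rewrite <- (Rmult_0_r (cumulant_weight m)), <- (Rplus_0_r 0) at 1.
    apply (CV_mult (fun _ => cumulant_weight m)); [apply Un_cv_const|].
    apply CV_plus; apply loc_error_cv; assumption || lia.
  - intros n Hn; rewrite Rmult_assoc, <- Rmult_plus_distr_l.
    apply cumulant_diff; intros ls Hls Hsum.
    assert (Hnil : ls <> nil) by (intros ->; simpl in Hsum; lia).
    pose proof (mindecay_pos cA' alpha n HcA') as HtA.
    pose proof (mindecay_pos cB' alpha n HcB') as HtB.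
    pose proof (hypH_decay cA cA' alpha (A n) n (fun r s => HA n r s Hn)) as HdA.
    pose proof (hypH_decay cB cB' alpha (B n) n (fun r s => HB n r s Hn)) as HdB.
    assert (HL : 0 <= 2 * INR m * Rpower (INR n) beta).
    { pose proof (pos_INR m); apply Rmult_le_pos; [lra|apply Rlt_le, exp_pos]. }
    destruct (@FiniteMatrices.defect_bound_finite n (2 * INR m * Rpower (INR n) beta) ls (A n) (B n) M
      cA (mindecay cA' alpha n) cB (mindecay cB' alpha n)) as [N0 HN0];
      try assumption.
    + unfold M; lra.
    + apply (op_norm_le_weaken _ MA); [unfold M; lra|apply HMA, Hn].
    + apply (op_norm_le_weaken _ MB); [unfold M; lra|apply HMB, Hn].
    + rewrite Hsum in HN0.
      apply (Cabs_le_limit (fun N => Csub (defect n ls (trunc N (B n)))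
                                          (defect n ls (trunc N (A n)))) _ _ N0 HN0).
      apply Ccv_sub.
      * exact (defect_trunc_cv _ _ n ls (decay_row_summable _ _ _ HtB HdB) Hnil).
      * exact (defect_trunc_cv _ _ n ls (decay_row_summable _ _ _ HtA HdA) Hnil).
Qed.
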